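(* There exists a sL-sequence $(x_n)_{n=1}^\infty\subseteq[0,1]$ for which $$\overline{D}\big((x_{n+h}-x_n)_{n=1}^\infty\big)=\frac12$$ for all $h\in\mathbb{N}$, where differences are taken modulo $1$.
   Context: Notation: $\mathbb{N}=\{1,2,3,\dots\}$; $m$ is Lebesgue measure on $[0,1]$. Differences of elements of $[0,1]$ are taken modulo $1$, with values in $[0,1)$. Discrepancy: for $(z_n)_{n=1}^N\subseteq[0,1]$, $D_N((z_n)_{n=1}^N)=\sup_{B}\left|\frac1N|\{1\le n\le N: z_n\in B\}|-m(B)\right|$, where $B$ ranges over all intervals contained in $[0,1]$. For an infinite sequence, $\overline{D}((z_n)_{n=1}^\infty)=\limsup_{N\to\infty}D_N((z_n)_{n=1}^N)$. Permissible triple: for a bounded complex sequence $(z_n)_{n=1}^\infty$ and an increasing sequence $(N_q)_{q=1}^\infty\subseteq\mathbb{N}$, the triple $((z_n),(z_n),(N_q))$ is permissible if $\lim_{q\to\infty}\frac1{N_q}\sum_{n=1}^{N_q}z_{n+h}\overline{z_n}$ exists for all integers $h\ge 0$. A bounded complex sequence $(z_n)_{n=1}^\infty$ is spectrally Lebesgue if for every permissible triple $((z_n),(z_n),(N_q))$ there is $f\in L^1([0,1],m)$ with $\lim_{q\to\infty}\frac1{N_q}\sum_{n=1}^{N_q}z_{n+h}\overline{z_n}=\int_0^1 f(x)e^{2\pi i hx}\,dx$ for all integers $h\ge0$. A sequence $(x_n)_{n=1}^\infty\subseteq[0,1]$ is a sL-sequence if for every (complex-valued) $f\in C([0,1])$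 with $\int_{[0,1]}f\,dm=0$ the sequence $(f(x_n))_{n=1}^\infty$ is spectrally Lebesgue. *)

(* Defs.v *)
From HB Require Import structures.
From mathcomp Require Import all_boot all_order all_algebra.
From mathcomp Require Import all_classical all_reals all_analysis.
From mathcomp Require Import complex.

Set Implicit Arguments.
Unset Strict Implicit.
Unset Printing Implicit Defensive.

Import Order.TTheory GRing.Theory Num.Theory.
Import numFieldNormedType.Exports.

Local Open Scope classical_set_scope.
Local Open Scope ring_scope.

(* [R[i]] comes without a topology; this gives it the one induced by its
   modulus, as for every numFieldType. *)
HB.instance Definition _ (R : realType) := NormedModule.copy R[i] R[i]^o.

(* A sequence (z_n) with n = 1, 2, 3, ... is encoded as z : nat -> T, the value
   z n standing for the (n+1)-st term z_{n+1}. *)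

Section ComplexIntegral.
Variable R : realType.

Definition unit_interval : set R := `[0, 1].

(* \int_0^1 f dm; Rintegral takes a junk value on non-integrable functions, so
   this is meaningful when L1 f holds. *)
Definition cintegral (f : R -> R[i]) : R[i] :=
  Complex (\int[lebesgue_measure]_(x in unit_interval) complex.Re (f x))
          (\int[lebesgue_measure]_(x in unit_interval) complex.Im (f x)).

Definition L1 (f : R -> R[i]) : Prop :=
  lebesgue_measure.-integrable unit_interval (fun x => (complex.Re (f x))%:E) /\
  lebesgue_measure.-integrable unit_interval (fun x => (complex.Im (f x))%:E).

(* e^{2 pi i t} *)
Definition e2pi (t : R) : R[i] := Complex (cos (2 * pi * t)) (sin (2 * pi * t)).

End ComplexIntegral.

Section SpectrallyLebesgue.
Variable R : realType.
Implicit Types (z : nat -> R[i]) (N : nat -> nat) (x : nat -> R).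

(* (1/n) \sum_{k = 1}^n z_{k+h} \overline{z_k} *)
Definition correlation z (h n : nat) : R[i] :=
  n%:R^-1 * \sum_(k < n) z (k + h)%N * (z k)^*.

(* The triple (z, z, N); N takes values in {1, 2, ...} and is strictly
   increasing. *)
Definition permissible z N : Prop :=
  [/\ bounded_fun z, increasing_seq N, forall q, (0 < N q)%N &
      forall h : nat, cvgn (fun q => correlation z h (N q))].

Definition spectrally_Lebesgue z : Prop :=
  bounded_fun z /\
  forall N, permissible z N ->
    exists f : R -> R[i], L1 f /\
      forall h : nat, (fun q => correlation z h (N q)) @ \oo -->
        cintegral (fun t => f t * e2pi (h%:R * t)).

Definition sL_sequence x : Prop :=
  (forall n, unit_interval (x n)) /\
  forall f : R -> R[i], {within @unit_interval R, continuous f} ->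
    cintegral f = 0 -> spectrally_Lebesgue (fun n => f (x n)).

End SpectrallyLebesgue.

Section Discrepancy.
Variable R : realType.
Implicit Types z : nat -> R.

(* D_N; degenerate (empty and one-point) intervals are allowed.  The supremum
   is over a nonempty set of reals in [0, 1]. *)
Definition discrepancy z (N : nat) : R :=
  sup [set `| #|[set k : 'I_N | z k \in B]|%:R / N%:R
              - fine (lebesgue_measure B) |
      | B in [set B : set R | is_interval B /\ B `<=` @unit_interval R]].

Definition upper_discrepancy z : R := limn_sup (discrepancy z).

(* a - b modulo 1, in [0, 1) *)
Definition sub_mod1 (a b : R) : R := (a - b) - (Num.floor (a - b))%:~R.

End Discrepancy.

(* Main.v *)
Require Import Defs.
From mathcomp Require Import all_boot all_order all_algebra.
From mathcomp Require Import all_classical all_reals all_analysis.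
From mathcomp Require Import measurable_realfun complex.
From mathcomp Require Import zify ring lra.

Set Implicit Arguments.
Unset Strict Implicit.
Unset Printing Implicit Defensive.

Import Order.TTheory GRing.Theory Num.Theory.
Import numFieldNormedType.Exports.

Local Open Scope classical_set_scope.
Local Open Scope ring_scope.

(** The sequence is made of longer and longer stages.  During stage k it follows
    a periodic word attached to a prime p > k and to a shift d.  Reading the word
    in blocks of p letters, each block runs along a line j |-> s * tau(j) + t of
    the affine plane over F_p, and a period of p^3 letters exhausts the p^2 pairs
    (s, t); letters are rescaled to [0, 1) by dividing by p.  The abscissa tau(j)
    is j, except that every second interval of length d is folded back onto the
    preceding one.  Through two points with distinct abscissae there is exactly
    one line, so over a period the pair of letters at positions j + h and j is
    uniform on the p x p grid when tau(j + h) and tau(j) differ, and uniform on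
    the diagonal when they agree.  For h > 0 they never agree if h differs from
    d, and they agree for half of the j if h = d ([overlap_other],
    [overlap_same], [word_pair_sum]).  Thus at stage k the differences at lag h
    are asymptotically uniform if h differs from d, and for h = d they are an
    even mixture of the uniform law and a point mass at 0.

    Stages grow so fast that a prefix only sees its last stage and the one before
    ([lag_average_approx]).  The shift of stage k is the 2-adic valuation of k:
    every h is used infinitely often, and of two consecutive stages one has shift
    0, hence no repetitions.

    Discrepancy.  A mixture giving mass at most 1/2 to a point and the rest to
    the uniform law is at distance at most 1/2 from the uniform law on every
    interval, and this bounds the upper limit.  At the end of a stage of shift h,
    the difference at lag h is 0 half of the time, and the interval [0, 0] shows
    that 1/2 is attained ([upper_discrepancy_lag_diff]).

    Spectrum.  Let f be continuous with mean zero and let V be the integral of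
    |f|^2.  The uniform part contributes |mean of f|^2 = 0 to the correlations,
    the diagonal part contributes V; so the correlation at lag h over the first N
    terms is c_h(N) V + o(1), where c_h(N) is the proportion of repetitions at
    lag h.  We have c_0(N) = 1, and for each N at most one h > 0 has c_h(N)
    nonzero ([lag_coef_disjoint]).  Along a permissible sequence of N the limit
    correlations therefore vanish except at 0 and at most one lag h0, and such
    numbers are the Fourier coefficients of V + c e^(-2 pi i h0 t)
    ([density_coef], [staged_seq_sL]). *)

(** * Periodic words whose letters are pairwise independent or equal *)

(** For d = 0 this is the identity, because j %/ 0 = 0. *)
Definition fold_index (d j : nat) : nat :=
  if odd (j %/ d) then (j - d)%N else j.

Lemma fold_index_le d j : (fold_index d j <= j)%N.
Proof. rewrite /fold_index; case: ifP => _ //; lia. Qed.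

Lemma fold_index_addl d j : (0 < d)%N ->
  (fold_index d (j + d) == fold_index d j) = ~~ odd (j %/ d).
Proof.
move=> d0; rewrite /fold_index divnDr ?dvdnn// divnn d0 addn1 /=.
case: ifP => [/negbTE -> | /negbFE ->]; first by rewrite addnK eqxx.
by apply/eqP; lia.
Qed.

(** Each index moves by 0 or by d, so two indices at distance h can only meet when
    h = d. *)
Lemma fold_index_inj d h j : (0 < h)%N -> h != d ->
  fold_index d (j + h) != fold_index d j.
Proof.
move=> h0 hd; rewrite /fold_index.
have le i : odd (i %/ d) -> (d <= i)%N.
  by case: (ltnP i d) => // id; rewrite divn_small.
by case: ifP => [/le|_]; case: ifP => [/le|_]; lia.
Qed.

Lemma count_late b h : (\sum_(j < b) (b <= j + h) <= h)%N.
Proof.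
have -> : (\sum_(j < b) (b <= j + h) = \sum_(j < b) (j < h))%N.
  rewrite (reindex_inj rev_ord_inj); apply: eq_bigr => j _ /=.
  by congr (nat_of_bool _); have := ltn_ord j; lia.
suff count m : (\sum_(j < m) (j < h) = minn m h)%N by rewrite count geq_minr.
by elim: m => [|m IH]; [rewrite big_ord0 min0n | rewrite big_ord_recr /= IH; lia].
Qed.

Section PeriodicWord.
Variable p : nat.
Hypothesis p_pr : prime p.

Let p_gt0 : (0 < p)%N := prime_gt0 p_pr.

(** With n = (s * p + t) * p + j this is the line of slope s and intercept t at
    the folded abscissa of j; casting to 'F_p reduces both parameters modulo p,
    which makes the word periodic. *)
Definition word (d n : nat) : 'F_p :=
  (n %/ p ^ 2)%:R * (fold_index d (n %% p))%:R + (n %/ p)%:R.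

Lemma word_block d s t j : (t < p)%N -> (j < p)%N ->
  word d ((s * p + t) * p + j) = s%:R * (fold_index d j)%:R + t%:R.
Proof.
move=> tp jp; rewrite /word modnMDl modn_small//.
rewrite expnS expn1 divnMA divnMDl// (divn_small jp) addn0.
rewrite divnMDl// (divn_small tp) addn0; congr (_ + _).
by rewrite natrD natrM (pchar_Fp_0 p_pr) mulr0 add0r.
Qed.

Lemma word_period d n : word d (n + p ^ 3) = word d n.
Proof.
have E1 : (p ^ 3 = p * p ^ 2)%N by rewrite expnS.
have E2 : (p ^ 3 = p ^ 2 * p)%N by rewrite E1 mulnC.
have F1 : ((n + p ^ 3) %/ p ^ 2 = p + n %/ p ^ 2)%N.
  by rewrite E1 addnC divnMDl// expn_gt0 p_gt0.
have F2 : ((n + p ^ 3) %/ p = p ^ 2 + n %/ p)%N by rewrite E2 addnC divnMDl.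
have F3 : ((n + p ^ 3) %% p = n %% p)%N by rewrite E2 addnC modnMDl.
rewrite /word F1 F2 F3.
by rewrite !natrD !natrX (pchar_Fp_0 p_pr) !expr0n /= !add0r.
Qed.

Lemma sum_Fp (V : nmodType) (f : 'F_p -> V) :
  \sum_(t < p) f t%:R = \sum_(x : 'F_p) f x.
Proof.
rewrite -(big_mkord xpredT (fun t => f t%:R)).
rewrite -[X in \sum_(0 <= _ < X) _](Fp_cast p_pr) big_mkord.
by apply: eq_bigr => x _; rewrite natr_Zp.
Qed.

Lemma sum_period (V : nmodType) (f : nat -> V) :
  \sum_(n < p ^ 3) f n =
  \sum_(j < p) \sum_(s < p) \sum_(t < p) f ((s * p + t) * p + j)%N.
Proof.
have mul a b (F : nat -> V) :
    \sum_(n < a * b) F n = \sum_(q < a) \sum_(r < b) F (q * b + r)%N.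
  rewrite -(big_mkord xpredT) big_nat_mul big_mkord; apply: eq_bigr => i _.
  by rewrite -{1}[(i * b)%N]add0n big_addn mulSn addnK big_mkord;
     apply: eq_bigr => j _; rewrite addnC.
rewrite (_ : p ^ 3 = p * p * p)%N; last by rewrite !expnS expn0 muln1 mulnA.
rewrite mul exchange_big; apply: eq_bigr => j _.
by rewrite (mul p p (fun q => f (q * p + j)%N)).
Qed.

Lemma sum_lines_distinct (V : nmodType) (g : 'F_p -> 'F_p -> V) a b : a != b ->
  \sum_(s : 'F_p) \sum_(t : 'F_p) g (s * a + t) (s * b + t) =
  \sum_x \sum_y g x y.
Proof.
move=> ab; have ab0 : a - b != 0 by rewrite subr_eq0.
rewrite !pair_big /= [RHS](reindex (fun u => (u.1 * a + u.2, u.1 * b + u.2)))//=.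
exists (fun v => let s := (v.1 - v.2) / (a - b) in (s, v.1 - s * a)) => -[x y] _ /=.
  by congr (_, _); field.
by congr (_, _); field.
Qed.

Lemma sum_lines_equal (V : nmodType) (g : 'F_p -> 'F_p -> V) a :
  \sum_(s : 'F_p) \sum_(t : 'F_p) g (s * a + t) (s * a + t) =
  (\sum_x g x x) *+ p.
Proof.
rewrite -[X in _ *+ X](card_Fp p_pr) -sumr_const; apply: eq_bigr => s _.
by rewrite [RHS](reindex_inj (addrI (s * a))).
Qed.

Lemma Fp_nat_eq a b : (a < p)%N -> (b < p)%N ->
  (a%:R == b%:R :> 'F_p) = (a == b).
Proof.
move=> ap bp; apply/eqP/eqP => [/(congr1 val)|->//].
by rewrite /= !val_Fp_nat// !modn_small.
Qed.

Definition overlap (d h : nat) : nat :=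
  \sum_(j < p) (fold_index d (j + h) == fold_index d j).

Lemma overlap0 d : overlap d 0 = p.
Proof.
rewrite /overlap (eq_bigr (fun=> 1%N)); first by rewrite sum1_card card_ord.
by move=> j _; rewrite addn0 eqxx.
Qed.

Lemma overlap_other d h : (0 < h)%N -> h != d -> overlap d h = 0%N.
Proof.
move=> h0 hd; rewrite /overlap big1// => j _.
by rewrite (negbTE (fold_index_inj j h0 hd)).
Qed.

(** Shifting by d exchanges the intervals of length d of even and odd rank, so
    among the first p integers both kinds occur equally often up to d. *)
Lemma overlap_same d : (0 < d)%N -> (p <= (overlap d d).*2 <= p + d)%N.
Proof.
move=> d0; pose E m := (\sum_(j < m) ~~ odd (j %/ d))%N.
pose O m := (\sum_(j < m) odd (j %/ d))%N.
have EO m : (E m + O m = m)%N.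
  rewrite /E /O -big_split /= (eq_bigr (fun=> 1%N)) => [|j _].
    by rewrite sum1_card card_ord.
  by case: odd.
have shift m : E m = O (d + m)%N.
  rewrite /O big_split_ord /= big1 ?add0n => [|j _].
    by apply: eq_bigr => j _; rewrite /= divnDl// divnn d0 oddD.
  by rewrite divn_small.
have Ole : (O p <= O (d + p) <= O p + d)%N.
  have : O (d + p)%N = (O p + \sum_(j < d) odd ((p + j) %/ d))%N.
    by rewrite /O addnC big_split_ord.
  have : (\sum_(j < d) odd ((p + j) %/ d) <= \sum_(j < d) 1)%N.
    by apply: leq_sum => j _; case: odd.
  by rewrite sum1_card card_ord => + ->; lia.
rewrite (_ : overlap d d = E p); last first.
  by apply: eq_bigr => j _; rewrite fold_index_addl.
by have := EO p; have := shift p; lia.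
Qed.

Section PairSum.
Variables (R : realFieldType) (g : 'F_p -> 'F_p -> R) (M : R).
Hypothesis gM : forall x y, `|g x y| <= M.

(** Only the last h letters of a block have their partner at distance h in a later
    block, on an unrelated line; they account for the error. *)
Lemma word_pair_sum d h :
  `| \sum_(n < p ^ 3) g (word d (n + h)) (word d n)
     - ((overlap d h)%:R * (p%:R * \sum_x g x x)
        + (p%:R - (overlap d h)%:R) * \sum_x \sum_y g x y) |
  <= 2 * M * h%:R * p%:R ^+ 2.
Proof.
have M0 : 0 <= M by apply: le_trans (normr_ge0 _) (gM 0 0).
set G1 := \sum_x g x x; set G2 := \sum_x \sum_y g x y.
have G1M : `|p%:R * G1| <= M * p%:R ^+ 2.
  rewrite normrM ger0_norm// expr2 mulrCA ler_wpM2l//.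
  rewrite (le_trans (ler_norm_sum _ _ _))//.
  by rewrite (le_trans (ler_sum _ (fun x _ => gM x x)))// sumr_const card_Fp//
    mulr_natr.
have G2M : `|G2| <= M * p%:R ^+ 2.
  rewrite (le_trans (ler_norm_sum _ _ _))//.
  rewrite (@le_trans _ _ (\sum_(x : 'F_p) (M * p%:R)))//; last first.
    by rewrite sumr_const card_Fp// -[leLHS]mulr_natr -mulrA -expr2.
  apply: ler_sum => x _; rewrite (le_trans (ler_norm_sum _ _ _))//.
  by rewrite (le_trans (ler_sum _ (fun y _ => gM x y)))// sumr_const card_Fp//
    mulr_natr.
pose same (j : nat) := fold_index d (j + h) == fold_index d j.
set pG1 := p%:R * G1 in G1M *.
pose target (j : nat) := if same j then pG1 else G2.
have -> : (overlap d h)%:R * pG1 + (p%:R - (overlap d h)%:R) * G2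
    = \sum_(j < p) target j.
  have -> : p%:R = \sum_(j < p) 1 :> R by rewrite sumr_const card_ord.
  rewrite /overlap natr_sum -sumrB.
  rewrite !mulr_suml -big_split /=.
  by apply: eq_bigr => j _; rewrite /target /same; case: eqP => _ /=; ring.
rewrite (sum_period (fun n => g (word d (n + h)) (word d n))) -sumrB (le_trans
  (ler_norm_sum _ _ _))//.
pose edge (j : nat) : R := 2 * M * p%:R ^+ 2 * (p <= j + h)%:R.
apply: (@le_trans _ _ (\sum_(j < p) edge j)).
  apply: ler_sum => j _; rewrite /edge.
  case: (leqP p (j + h)) => jh; rewrite ?mulr1 ?mulr0.
    rewrite (le_trans (ler_normB _ _))//.
    rewrite [leRHS](_ : _ = M * p%:R ^+ 2 + M * p%:R ^+ 2); last by ring.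
    apply: lerD; last by rewrite /target; case: ifP.
    rewrite (le_trans (ler_norm_sum _ _ _))//.
    rewrite (@le_trans _ _ (\sum_(s < p) (M * p%:R)))//; last first.
      by rewrite sumr_const card_ord -[leLHS]mulr_natr -mulrA -expr2.
    apply: ler_sum => s _; rewrite (le_trans (ler_norm_sum _ _ _))//.
    by rewrite (le_trans (ler_sum _ (fun t _ => gM _ _)))//
      sumr_const card_ord mulr_natr.
  rewrite normr_le0 subr_eq0; apply/eqP.
  (* Both positions lie in the same block, hence on the same line. *)
  pose a : 'F_p := (fold_index d (j + h))%:R; pose b : 'F_p := (fold_index d j)%:R.
  transitivity (\sum_(s : 'F_p) \sum_(t : 'F_p) g (s * a + t) (s * b + t)).
    rewrite -(sum_Fp (fun s => \sum_(t : 'F_p) g (s * a + t) (s * b + t))).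
    apply: eq_bigr => s _; rewrite -(sum_Fp (fun t => g (_ * a + t) (_ * b + t))).
    by apply: eq_bigr => t _; rewrite -addnA !word_block.
  have ab : (a == b) = same j.
    by rewrite Fp_nat_eq// (leq_ltn_trans (fold_index_le _ _)).
  rewrite /target -ab; case: eqP => [->|/eqP ne].
    by rewrite sum_lines_equal /pG1 mulr_natl.
  exact: sum_lines_distinct.
rewrite /edge -mulr_sumr [leRHS]mulrAC ler_wpM2l ?mulr_ge0 ?exprn_ge0//.
rewrite -natr_sum ler_nat.
exact: count_late.
Qed.

End PairSum.
End PeriodicWord.

(** * Stages *)

Lemma periodic_sum (R : realFieldType) (F : nat -> R) (M : R) (l N : nat) :
  (0 < l)%N -> (forall n, F (n + l)%N = F n) -> (forall n, `|F n| <= M) ->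
  `|\sum_(n < N) F n - N%:R * ((\sum_(n < l) F n) / l%:R)| <= 2 * M * l%:R.
Proof.
move=> l0 Fl FM; set m := _ / l%:R.
have l0R : 0 < l%:R :> R by rewrite ltr0n.
pose D N := \sum_(n < N) (F n - m).
have -> : \sum_(n < N) F n - N%:R * m = D N.
  by rewrite /D sumrB sumr_const card_ord mulr_natl.
have mM : `|m| <= M.
  rewrite normrM normfV (gtr0_norm l0R) ler_pdivrMr//.
  rewrite (le_trans (ler_norm_sum _ _ _))//.
  by rewrite (le_trans (ler_sum _ (fun (n : 'I_l) _ => FM n)))//
    sumr_const card_ord mulr_natr.
have M0 : 0 <= M by apply: le_trans (normr_ge0 _) mM.
have Dl : D l = 0.
  rewrite /D sumrB sumr_const card_ord -mulr_natr /m divfK ?subrr//.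
  exact: lt0r_neq0.
have DlD n : D (l + n)%N = D n.
  rewrite {1}/D big_split_ord /= -/(D l) Dl add0r.
  by apply: eq_bigr => i _; rewrite addnC Fl.
elim/ltn_ind: N => N IH; case: (ltnP N l) => Nl; last first.
  by rewrite -(subnKC Nl) DlD; apply: IH; lia.
rewrite (le_trans (ler_norm_sum _ _ _))//.
rewrite (@le_trans _ _ (\sum_(n < N) (2 * M)))//.
  apply: ler_sum => n _; rewrite (le_trans (ler_normB _ _))//.
  by have := FM n; lra.
by rewrite sumr_const card_ord -[leLHS]mulr_natr ler_wpM2l ?mulr_ge0// ler_nat ltnW.
Qed.

Lemma convex_dist (R : realFieldType) (l a b c e : R) : 0 <= l <= 1 -> `|a -
  c| <= e -> `|b - c| <= e ->
  `|l * a + (1 - l) * b - c| <= e.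
Proof.
move=> /andP[l0 l1] ac bc.
have -> : l * a + (1 - l) * b - c = l * (a - c) + (1 - l) * (b - c) by ring.
rewrite (le_trans (ler_normD _ _))// !normrM (ger0_norm l0) (@ger0_norm _ (1 -
  l)) ?subr_ge0//.
have -> : e = l * e + (1 - l) * e by ring.
by apply: lerD; rewrite ler_wpM2l ?subr_ge0.
Qed.

Definition stage_prime (k : nat) : nat := s2val (prime_above k).

Lemma stage_prime_prime k : prime (stage_prime k).
Proof. exact: (s2valP' (prime_above k)). Qed.

Lemma stage_prime_gt k : (k < stage_prime k)%N.
Proof. exact: (s2valP (prime_above k)). Qed.

(** The 2-adic valuation takes every value infinitely often and vanishes at odd k,
    so that of two consecutive stages at least one has no repetitions. *)
Definition stage_shift (k : nat) : nat := logn 2 k.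

(** The factor in front makes stage i last so long that everything before it, and
    the periods of its word and of the next one, are negligible at its end. *)
Fixpoint stage_start (k : nat) : nat :=
  if k is i.+1 then
    (i.+1 * (stage_start i + stage_prime i ^ 3 + stage_prime i.+1 ^ 3))%N
  else 0%N.

Lemma stage_startS k : stage_start k.+1 =
  (k.+1 * (stage_start k + stage_prime k ^ 3 + stage_prime k.+1 ^ 3))%N.
Proof. by []. Qed.

Lemma stage_start_lt k : (stage_start k < stage_start k.+1)%N.
Proof.
have := stage_prime_prime k => /prime_gt0 p0.
have : (0 < stage_prime k ^ 3)%N by rewrite expn_gt0 p0.
rewrite stage_startS; nia.
Qed.

Lemma stage_start_mono : {mono stage_start : i j / (i <= j)%N}.
Proof. by apply: leq_mono; apply: (homo_ltn ltn_trans); exact: stage_start_lt. Qed.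

Lemma stage_start_ge k : (k <= stage_start k)%N.
Proof. by elim: k => // k IH; apply: leq_ltn_trans (stage_start_lt k). Qed.

Lemma stage_exists n : exists k, (n < stage_start k.+1)%N.
Proof. by exists n; apply: stage_start_ge. Qed.

Definition stage (n : nat) : nat := ex_minn (stage_exists n).

Lemma stageP n : (stage_start (stage n) <= n < stage_start (stage n).+1)%N.
Proof.
rewrite /stage; case: ex_minnP => -[|k] nk kmin; rewrite nk andbT//.
by rewrite leqNgt; apply/negP => /kmin; rewrite ltnn.
Qed.

Lemma stage_eq n k : (stage_start k <= n < stage_start k.+1)%N -> stage n = k.
Proof.
case/andP => kn nk; have /andP[sn ns] := stageP n.
have := leq_ltn_trans sn nk; have := leq_ltn_trans kn ns.
rewrite !ltnNge !stage_start_mono; lia.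
Qed.

Lemma stage_le n k : (k <= stage n)%N = (stage_start k <= n)%N.
Proof.
have /andP[sn ns] := stageP n; apply/idP/idP => [|kn].
  by rewrite -stage_start_mono => /leq_trans; apply.
by have := leq_ltn_trans kn ns; rewrite ltnNge stage_start_mono -ltnNge.
Qed.

Section Averages.
Variable R : realType.

Definition grid (p : nat) (a : 'F_p) : R := (a : nat)%:R / p%:R.

Lemma grid_itv p (a : 'F_p) : prime p -> 0 <= grid a < 1.
Proof.
move=> p_pr; have p0 : 0 < p%:R :> R by rewrite ltr0n prime_gt0.
rewrite /grid divr_ge0//= ltr_pdivrMr// mul1r ltr_nat.
by have := ltn_ord a; rewrite [X in (_ < X)%N](Fp_cast p_pr).
Qed.

Definition stage_word (k n : nat) : R := grid (word (stage_prime k) (stage_shift k) n).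

Definition staged_seq (n : nat) : R := stage_word (stage n) n.

Lemma stage_word_itv k n : 0 <= stage_word k n < 1.
Proof. exact/grid_itv/stage_prime_prime. Qed.

Definition diag_mean (g : R -> R -> R) p : R :=
  (\sum_(a : 'F_p) g (grid a) (grid a)) / p%:R.

Definition pair_mean (g : R -> R -> R) p : R :=
  (\sum_(a : 'F_p) \sum_(b : 'F_p) g (grid a) (grid b)) / p%:R ^+ 2.

Definition overlap_ratio h k : R :=
  (overlap (stage_prime k) (stage_shift k) h)%:R / (stage_prime k)%:R.

Definition stage_mean g h k : R :=
  overlap_ratio h k * diag_mean g (stage_prime k)
  + (1 - overlap_ratio h k) * pair_mean g (stage_prime k).

Definition stage_weight (N : nat) : R := (stage_start (stage N))%:R / N%:R.

Definition lag_average (g : R -> R -> R) (h N : nat) : R :=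
  (\sum_(n < N) g (staged_seq (n + h)) (staged_seq n)) / N%:R.

Definition bounded_on_square (g : R -> R -> R) (M : R) : Prop :=
  forall u v, 0 <= u < 1 -> 0 <= v < 1 -> `|g u v| <= M.

Section Bounded.
Variables (g : R -> R -> R) (M : R) (h : nat).
Hypothesis gM : bounded_on_square g M.

Let M_ge0 : 0 <= M.
Proof. by apply: le_trans (normr_ge0 _) (gM _ _) => //;
  exact: (stage_word_itv 0 0). Qed.

Lemma stage_word_mean k :
  `|(\sum_(n < stage_prime k ^ 3) g (stage_word k (n + h)) (stage_word k n))
      / (stage_prime k ^ 3)%:R - stage_mean g h k|
  <= 2 * M * h%:R / (stage_prime k)%:R.
Proof.
set p := stage_prime k.
have p_pr : prime p := stage_prime_prime k.
have p0 : 0 < p%:R :> R by rewrite ltr0n prime_gt0.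
have gMp (a b : 'F_p) : `|g (grid a) (grid b)| <= M.
  by apply: gM; exact: grid_itv.
have := word_pair_sum p_pr gMp (stage_shift k) h.
set S := \sum_(n < _) _; set G2 := \sum_x \sum_y _; set G1 := \sum_x _.
set D := (overlap p _ _)%:R => H.
have -> : stage_mean g h k =
    (D * (p%:R * G1) + (p%:R - D) * G2) / (p ^ 3)%:R.
  by rewrite /stage_mean /diag_mean /pair_mean /overlap_ratio natrX -/p -/D -/G1 -/G2;
    field; rewrite lt0r_neq0.
rewrite -mulrBl normrM normfV (@ger0_norm _ (p ^ 3)%:R)//.
rewrite ler_pdivrMr ?natrX ?exprn_gt0// (le_trans H)// le_eqVlt; apply/orP; left.
by apply/eqP; field; rewrite lt0r_neq0.
Qed.

Lemma overlap_ratio_itv k : 0 <= overlap_ratio h k <= 1.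
Proof.
have p0 : 0 < (stage_prime k)%:R :> R by rewrite ltr0n prime_gt0// stage_prime_prime.
rewrite /overlap_ratio divr_ge0//= ler_pdivrMr// mul1r ler_nat.
rewrite -[leqRHS](card_ord) -sum1_card; apply: leq_sum => j _; exact: leq_b1.
Qed.

Lemma stage_mean_le k : `|stage_mean g h k| <= M.
Proof.
have p_pr := stage_prime_prime k; rewrite /stage_mean; set p := stage_prime k in p_pr *.
have p0 : 0 < p%:R :> R by rewrite ltr0n prime_gt0.
have gMp (a b : 'F_p) : `|g (grid a) (grid b)| <= M.
  by apply: gM; exact: grid_itv.
have diagM : `|diag_mean g p| <= M.
  rewrite normrM normfV (gtr0_norm p0) ler_pdivrMr//.
  rewrite (le_trans (ler_norm_sum _ _ _))//.
  by rewrite (le_trans (ler_sum _ (fun x _ => gMp x x)))// sumr_const card_Fp//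
    mulr_natr.
have pairM : `|pair_mean g p| <= M.
  rewrite normrM normfV (@gtr0_norm _ (p%:R ^+ 2)) ?exprn_gt0//
    ler_pdivrMr ?exprn_gt0//.
  rewrite (le_trans (ler_norm_sum _ _ _))//.
  rewrite (@le_trans _ _ (\sum_(x : 'F_p) (M * p%:R)))//; last first.
    by rewrite sumr_const card_Fp// -[leLHS]mulr_natr -mulrA -expr2.
  apply: ler_sum => x _; rewrite (le_trans (ler_norm_sum _ _ _))//.
  by rewrite (le_trans (ler_sum _ (fun y _ => gMp x y)))// sumr_const card_Fp//
    mulr_natr.
rewrite -[X in `|X|]subr0; apply: convex_dist; rewrite ?subr0//.
exact: overlap_ratio_itv.
Qed.

Lemma stage_sum k a b : (stage_start k <= a <= b)%N -> (b <= stage_start k.+1)%N ->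
  `|\sum_(a <= n < b) g (staged_seq (n + h)) (staged_seq n)
    - (b - a)%:R * stage_mean g h k|
  <= M * (2 * h%:R + 4 * (stage_prime k ^ 3)%:R
          + 2 * h%:R * ((b - a)%:R / (stage_prime k)%:R)).
Proof.
move=> /andP[ka ab] bk; set p := stage_prime k.
have p_pr : prime p := stage_prime_prime k.
pose F n := g (stage_word k (n + h)) (stage_word k n).
have FM n : `|F n| <= M by apply: gM; exact: stage_word_itv.
have Fp n : F (n + p ^ 3)%N = F n.
  by rewrite /F /stage_word -addnA (addnC _ h) addnA !word_period// stage_prime_prime.
set m := (\sum_(n < p ^ 3) F n) / (p ^ 3)%:R.
have l0 : (0 < p ^ 3)%N by rewrite expn_gt0 prime_gt0.
have per N := periodic_sum N l0 Fp FM.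
have mean : `|m - stage_mean g h k| <= 2 * M * h%:R / p%:R := stage_word_mean k.
have cut : `|\sum_(a <= n < b) g (staged_seq (n + h)) (staged_seq n)
    - \sum_(a <= n < b) F n| <= 2 * M * h%:R.
  rewrite -sumrB (le_trans (ler_norm_sum _ _ _))//.
  apply: (@le_trans _ _ (\sum_(a <= n < b) (2 * M * (b <= n + h)%N%:R))).
    rewrite big_nat_cond [leRHS]big_nat_cond; apply: ler_sum => n.
    rewrite andbT => /andP[an nb].
    have nk : stage n = k.
      by apply: stage_eq; rewrite (leq_trans ka an) (leq_trans nb bk).
    have -> : staged_seq n = stage_word k n by rewrite /staged_seq nk.
    case: (leqP b (n + h)) => bnh; rewrite ?mulr1 ?mulr0.
      rewrite (le_trans (ler_normB _ _))// mulr_natl mulr2n lerD//.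
      by apply: gM; exact: stage_word_itv.
    have nhk : stage (n + h) = k.
      apply: stage_eq; rewrite (leq_trans bnh bk) andbT.
      by rewrite (leq_trans ka (leq_trans an (leq_addr _ _))).
    by rewrite /staged_seq nhk subrr normr0.
  rewrite -mulr_sumr ler_wpM2l ?mulr_ge0// -natr_sum ler_nat.
  rewrite (leq_trans _ (count_late b h))// -(big_mkord xpredT (fun n =>
    nat_of_bool (b <= n + h)%N)).
  by rewrite [leqRHS](big_cat_nat (leq0n a) ab)//= leq_addl.
have sumF : \sum_(a <= n < b) F n = \sum_(n < b) F n - \sum_(n < a) F n.
  by rewrite -!(big_mkord xpredT) (big_cat_nat (leq0n a) ab)//= [X in _ = X -
    _]addrC addrK.
have := per a; have := per b; rewrite -/m.
move: cut mean; rewrite sumF.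
move: (\sum_(a <= n < b) _) (\sum_(n < b) _) (\sum_(n < a) _) (stage_mean _ _ _) m =>
  S Sb Sa m' m.
have ba0 : 0 <= (b - a)%:R :> R by [].
have -> : b%:R = a%:R + (b - a)%:R :> R by rewrite natrB// addrC subrK.
move: (b - a)%:R ba0 => c c0.
have p0 : 0 < p%:R :> R by rewrite ltr0n prime_gt0.
move=> H1 H2 H3 H4.
have H5 : `|c * m - c * m'| <= c * (2 * M * h%:R / p%:R).
  by rewrite -mulrBr normrM (ger0_norm c0) ler_wpM2l.
have -> : S - c * m' = (S - (Sb - Sa)) + (Sb - (a%:R + c) * m) - (Sa - a%:R * m)
   + (c * m - c * m') by ring.
have -> : M * (2 * h%:R + 4 * (p ^ 3)%:R + 2 * h%:R * (c / p%:R)) =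
  2 * M * h%:R + 2 * M * (p ^ 3)%:R + 2 * M * (p ^ 3)%:R + c * (2 * M * h%:R / p%:R)
    by ring.
rewrite (le_trans (ler_normD _ _))// lerD// (le_trans (ler_normB _ _))// lerD//.
by rewrite (le_trans (ler_normD _ _))// lerD.
Qed.

(** Stages before the last two occupy at most N divided by [stage N] terms, and
    within each of the last two the average over a long time is the average over
    a period. *)
Lemma lag_average_approx N : (0 < stage N)%N ->
  `|lag_average g h N - (stage_weight N * stage_mean g h (stage N).-1
                         + (1 - stage_weight N) * stage_mean g h (stage N))|
  <= M * (4 + 6 * h%:R) / (stage N)%:R.
Proof.
move=> sN; pose k := (stage N).-1; pose lam := stage_weight N.
have sk : stage N = k.+1 by rewrite prednK.
rewrite -/k sk -/lam.
have /andP[kN Nk] : (stage_start k.+1 <= N < stage_start k.+2)%N.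
  by rewrite -sk; exact: stageP.
set T1 := stage_start k.+1 in kN *.
pose T0 := stage_start k; pose P := stage_prime k; pose Q := stage_prime k.+1.
have T01 : (T0 <= T1)%N := ltnW (stage_start_lt k).
have S0 : `|\sum_(0 <= n < T0) g (staged_seq (n + h)) (staged_seq n)| <= M * T0%:R.
  rewrite big_mkord (le_trans (ler_norm_sum _ _ _))//.
  rewrite -[X in M * X%:R](card_ord T0) mulr_natr -sumr_const ler_sum// => n _.
  by apply: gM; exact: stage_word_itv.
have S1 : `|\sum_(T0 <= n < T1) g (staged_seq (n + h)) (staged_seq n)
    - (T1 - T0)%:R * stage_mean g h k|
  <= M * (2 * h%:R + 4 * (P ^ 3)%:R + 2 * h%:R * ((T1 - T0)%:R / P%:R)).
  by apply: stage_sum; rewrite ?leqnn.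
have S2 : `|\sum_(T1 <= n < N) g (staged_seq (n + h)) (staged_seq n)
    - (N - T1)%:R * stage_mean g h k.+1|
  <= M * (2 * h%:R + 4 * (Q ^ 3)%:R + 2 * h%:R * ((N - T1)%:R / Q%:R)).
  by apply: stage_sum; rewrite ?leqnn ?kN// ltnW.
have T1E : T1%:R = k.+1%:R * (T0%:R + (P ^ 3)%:R + (Q ^ 3)%:R) :> R.
  by rewrite -!natrD -natrM.
have k1T1 : k.+1%:R <= T1%:R :> R by rewrite ler_nat stage_start_ge.
have T1N : T1%:R <= N%:R :> R by rewrite ler_nat.
have Pk : k.+1%:R <= P%:R :> R by rewrite ler_nat stage_prime_gt.
have Qk : k.+1%:R <= Q%:R :> R by rewrite ler_nat ltnW// stage_prime_gt.
have k0 : 0 < k.+1%:R :> R by rewrite ltr0n.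
have N0 : 0 < N%:R :> R by apply: lt_le_trans (le_trans k1T1 T1N).
have mM : `|T0%:R * stage_mean g h k| <= M * T0%:R.
  by rewrite normrM ger0_norm// mulrC ler_wpM2r// stage_mean_le.
have PT : (T1 - T0)%:R / P%:R <= (T1 - T0)%:R / k.+1%:R :> R.
  by rewrite ler_wpM2l// lef_pV2// posrE// (lt_le_trans k0).
have QT : (N - T1)%:R / Q%:R <= (N - T1)%:R / k.+1%:R :> R.
  by rewrite ler_wpM2l// lef_pV2// posrE// (lt_le_trans k0).
have -> : lag_average g h N - (lam * stage_mean g h k + (1 - lam) * stage_mean g h k.+1)
  = (\sum_(0 <= n < T0) g (staged_seq (n + h)) (staged_seq n)
     + (\sum_(T0 <= n < T1) g (staged_seq (n + h)) (staged_seq n)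
       - (T1 - T0)%:R * stage_mean g h k)
     + (\sum_(T1 <= n < N) g (staged_seq (n + h)) (staged_seq n)
       - (N - T1)%:R * stage_mean g h k.+1)
     - T0%:R * stage_mean g h k) / N%:R.
  rewrite /lag_average -(big_mkord xpredT (fun n =>
    g (staged_seq (n + h)) (staged_seq n))).
  rewrite (big_cat_nat (leq0n T1) kN)/= (big_cat_nat (leq0n T0) T01)/=.
  by rewrite /lam /stage_weight sk -/T1 !natrB//; field; rewrite lt0r_neq0.
rewrite normrM normfV (gtr0_norm N0) ler_pdivrMr//.
rewrite (le_trans (ler_normB _ _))// (le_trans (lerD (ler_normD _ _) mM))//.
rewrite (le_trans (lerD (lerD (le_trans (ler_normD _ _) (lerD S0 S1)) S2) (lexx _)))//.
rewrite [leRHS](_ : _ = M * ((4 + 6 * h%:R) * (N%:R / k.+1%:R))); last by ring.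
rewrite -!mulrDr ler_wpM2l//.
have NE : (T1 - T0)%:R / k.+1%:R + (N - T1)%:R / k.+1%:R <= N%:R / k.+1%:R :> R.
  by rewrite -mulrDl ler_wpM2r// ?invr_ge0// !natrB//; have := ler0n R T0; lra.
have TE : T0%:R + (P ^ 3)%:R + (Q ^ 3)%:R <= N%:R / k.+1%:R :> R.
  by rewrite ler_pdivlMr// mulrC -T1E.
have one : 1 <= N%:R / k.+1%:R :> R by rewrite ler_pdivlMr// mul1r (le_trans k1T1).
have h0 := ler0n R h; have T00 := ler0n R T0.
have H1 : 2 * h%:R * ((T1 - T0)%:R / P%:R) + 2 * h%:R * ((N - T1)%:R / Q%:R)
   <= 2 * h%:R * (N%:R / k.+1%:R) :> R.
  by rewrite -mulrDr ler_wpM2l ?mulr_ge0// (le_trans _ NE)// lerD.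
have H2 : h%:R <= h%:R * (N%:R / k.+1%:R) :> R by rewrite ler_peMr.
have E2 : (4 + 6 * h%:R) * (N%:R / k.+1%:R) =
  4 * (N%:R / k.+1%:R) + 6 * (h%:R * (N%:R / k.+1%:R)) :> R by ring.
rewrite {}E2.
have E3 : 2 * h%:R * (N%:R / k.+1%:R) = 2 * (h%:R * (N%:R / k.+1%:R)) :> R by ring.
move: (ler0n R (P ^ 3)) (ler0n R (Q ^ 3)) TE H1 H2.
rewrite E3.
move: ((P ^ 3)%:R : R) ((Q ^ 3)%:R : R) => x y x0 y0.
move: (2 * h%:R * ((T1 - T0)%:R / P%:R) : R) (2 * h%:R * ((N - T1)%:R / Q%:R) : R) =>
  a b.
move: (h%:R * (N%:R / k.+1%:R) : R) (N%:R / k.+1%:R : R) => d e TE H1 H2.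
by lra.
Qed.

End Bounded.
End Averages.

(** * Riemann sums of continuous functions *)

Section Riemann.
Variable R : realType.
Notation mu := (@lebesgue_measure R).

(** Heine's theorem, from the description of compactness by near coverings. *)
Lemma compact_unif_continuous (A : set R) (f : R -> R) (e : R) :
  compact A -> {within A, continuous f} -> 0 < e ->
  exists2 d : R, 0 < d & forall x y, A x -> A y -> `|x - y| < d ->
    `|f x - f y| < e.
Proof.
move=> /compact_near_coveringP cA /subspace_continuousP fc e0.
pose P (d x : R) := A x -> forall y, A y -> `|x - y| < d -> `|f x - f y| < e.
have : \forall d \near (0 : R)^'+, A `<=` P d.
  apply: cA => x Ax.
  have [r /= r0 xr] : exists2 r : R, 0 < r &
      forall y, A y -> `|x - y| < r -> `|f x - f y| < e / 2.
    have /cvgrPdist_lt/(_ (e / 2)) := fc x Ax.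
    rewrite divr_gt0// => /(_ isT); rewrite near_withinE => -[r /= r0 xr].
    by exists r => // y Ay xy; apply: xr.
  exists (ball x (r / 2), [set d : R | d < r / 2]); first split => /=.
  - by apply: nbhsx_ballx; rewrite divr_gt0.
  - by apply: nbhs_right_lt; rewrite divr_gt0.
  - move=> [z d] /= [xz dr] Az y Ay zy.
    have xy : `|x - y| < r.
      rewrite -(subrKA z) (le_lt_trans (ler_normD _ _))// [ltRHS]splitr ltrD//.
      exact: lt_trans dr.
    rewrite -(subrKA (f x)) (le_lt_trans (ler_normD _ _))// [ltRHS]splitr ltrD ?xr//.
    by rewrite distrC xr// (lt_trans xz)// ltr_pdivrMr// mulr_natr mulr2n ltrDl.
move=> [d /= d0 dP].
exists (d / 2); first by rewrite divr_gt0.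
move=> x y Ax Ay; apply: dP => //=; last by rewrite divr_gt0.
by rewrite sub0r normrN gtr0_norm ?divr_gt0// ltr_pdivrMr// mulr_natr mulr2n ltrDl.
Qed.

(** On each cell the integral differs from the value at the left end times the
    length by at most the oscillation of f times the length. *)
Lemma riemann_sum (f : R -> R) : {within `[0, 1], continuous f} ->
  (fun n => (\sum_(i < n) f (i%:R / n%:R)) / n%:R) @ \oo -->
  \int[mu]_(x in `[0, 1]) f x.
Proof.
move=> fc.
have intf : mu.-integrable `[0, 1] (EFin \o f).
  by apply: continuous_compact_integrable => //; exact: segment_compact.
apply/cvgrPdist_le => e e0.
have [d d0 fd] := compact_unif_continuous (@segment_compact _ _ _) fc e0.
near=> n.
have n0 : (0 < n)%N by near: n; exact: nbhs_infty_gt.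
have n0R : 0 < n%:R :> R by rewrite ltr0n.
have nd : n%:R^-1 < d.
  rewrite invf_plt ?posrE//; near: n; exact: nbhs_infty_gtr.
pose I k := \int[mu]_(x in `[0, k%:R / n%:R]) f x.
have step k : (k < n)%N -> `|I k.+1 - I k - f (k%:R / n%:R) / n%:R| <= e / n%:R.
  move=> kn; set a := k%:R / n%:R; pose b : R := k.+1%:R / n%:R.
  have ab : b - a = n%:R^-1 by rewrite /a /b -mulrBl -natr1 addrAC subrr add0r mul1r.
  have a0 : 0 <= a by rewrite divr_ge0.
  have b1 : b <= 1 by rewrite ler_pdivrMr// mul1r ler_nat.
  have ltab : a < b by rewrite -subr_gt0 ab invr_gt0.
  have sub : `]a, b] `<=` `[0, 1].
    by apply: subset_itv; rewrite bnd_simp.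
  have intab : mu.-integrable `]a, b] (EFin \o f) by apply: integrableS intf.
  have mab : fine (mu `]a, b]) = n%:R^-1.
    by rewrite lebesgue_measure_itv/= lte_fin ltab -EFinB/= ab.
  have intc c : mu.-integrable `]a, b] (EFin \o cst c).
    by apply: integrableS (_ : mu.-integrable `[0, 1] _) => //;
      apply: continuous_compact_integrable => //;
      [exact: segment_compact|exact: cst_continuous].
  have -> : I k.+1 - I k = \int[mu]_(x in `]a, b]) f x.
    apply: Rintegral_itvB; rewrite ?bnd_simp//; last exact: ltW.
    by apply: integrableS intf => //; apply: subset_itv; rewrite bnd_simp.
  have -> : f a / n%:R = \int[mu]_(x in `]a, b]) cst (f a) x.
    by rewrite Rintegral_cst// mab.
  rewrite -RintegralB//.
  have intB : mu.-integrable `]a, b] (EFin \o (fun x => f x - cst (f a) x)).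
    exact: (integrableB _ intab (intc (f a))).
  rewrite (le_trans (le_normr_Rintegral _ intB))//.
  have -> : e / n%:R = \int[mu]_(x in `]a, b]) cst e x by rewrite Rintegral_cst// mab.
  apply: le_Rintegral => //.
    exact: (integrable_abse intB).
  move=> x /= /[dup] /sub x01; rewrite in_itv /= => /andP[ax xb].
  apply/ltW/fd => //; first by rewrite /= in_itv /= a0 (le_trans (ltW ltab)).
  by rewrite gtr0_norm ?subr_gt0// (le_lt_trans _ nd)// -ab lerB.
have sumI k : (k <= n)%N -> `|I k - (\sum_(i < k) f (i%:R / n%:R)) / n%:R| <= k%:R *
  (e / n%:R).
  elim: k => [_|k IH kn].
    by rewrite big_ord0 mul0r mul0r subr0 /I mul0r set_itv1 Rintegral_set1 normr0.
  rewrite big_ord_recr /= mulrDl.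
  have -> : I k.+1 - ((\sum_(i < k) f (i%:R / n%:R)) / n%:R + f (k%:R / n%:R) / n%:R)
   = (I k - (\sum_(i < k) f (i%:R / n%:R)) / n%:R) + (I k.+1 - I k -
     f (k%:R / n%:R) / n%:R).
    by ring.
  by rewrite -natr1 mulrDl mul1r (le_trans (ler_normD _ _))// lerD ?IH ?step// ltnW.
have := sumI n (leqnn n).
by rewrite /I divff ?lt0r_neq0// mulrCA divff ?mulr1 ?lt0r_neq0.
Unshelve. all: by end_near. Qed.
End Riemann.

(** * Differences modulo one *)

Section Discrepancy.
Variable R : realType.
Notation mu := (@lebesgue_measure R).

Lemma sub_mod1_eq (u v t : R) (m : int) :
  u - v = t + m%:~R -> 0 <= t < 1 -> sub_mod1 u v = t.
Proof.
move=> uvE t01; rewrite /sub_mod1 uvE (floor_def (m := m)); first by rewrite addrK.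
by rewrite intrD; move: t01; lra.
Qed.

Lemma sub_mod1xx (u : R) : sub_mod1 u u = 0.
Proof. by apply: (@sub_mod1_eq _ _ _ 0); rewrite ?subrr ?addr0 ?lexx ?ltr01. Qed.

Lemma sub_mod1_grid p (a b : 'F_p) : prime p ->
  sub_mod1 (grid R a) (grid R b) = grid R (a - b).
Proof.
move=> p_pr; have p0 : p%:R != 0 :> R by rewrite pnatr_eq0 -lt0n prime_gt0.
have lt (c : 'F_p) : (c < p)%N by rewrite -[X in (_ < X)%N](Fp_cast p_pr).
have E (c : 'F_p) : (c : nat)%:R = c by rewrite natr_Zp.
case: (leqP b a) => ba.
  apply: (@sub_mod1_eq _ _ _ 0); last exact: grid_itv.
  rewrite addr0 -[in RHS](E a) -[in RHS](E b) -natrB// /grid val_Fp_nat//.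
  by rewrite modn_small ?natrB//; [field | have := lt a; lia].
apply: (@sub_mod1_eq _ _ _ (-1)); last exact: grid_itv.
have -> : a - b = (a + p - b)%N%:R.
  by rewrite natrB ?natrD ?E ?(pchar_Fp_0 p_pr) ?addr0//; have := lt b; lia.
rewrite /grid val_Fp_nat// modn_small; last by have := lt a; lia.
rewrite natrB; last by have := lt b; lia.
by rewrite natrD; field.
Qed.

Definition diff_indic (B : set R) (u v : R) : R := \1_B (sub_mod1 u v).

Lemma diag_mean_diff_indic B p : prime p -> diag_mean (diff_indic B) p = \1_B (0 : R).
Proof.
move=> p_pr; have p0 : p%:R != 0 :> R by rewrite pnatr_eq0 -lt0n prime_gt0.
rewrite /diag_mean (eq_bigr (fun=> \1_B (0 : R))); last first.
  by move=> a _; rewrite /diff_indic sub_mod1xx.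
by rewrite sumr_const card_Fp// -[X in X / _]mulr_natr mulfK.
Qed.

Lemma sum_Fp_val (V : nmodType) p (f : nat -> V) : prime p ->
  \sum_(a : 'F_p) f a = \sum_(i < p) f i.
Proof.
move=> p_pr; rewrite -(big_mkord xpredT) -[in RHS](big_mkord xpredT).
by rewrite Fp_cast.
Qed.

Lemma pair_mean_diff_indic B p : prime p ->
  pair_mean (diff_indic B) p = (\sum_(i < p) \1_B (i%:R / p%:R : R)) / p%:R.
Proof.
move=> p_pr; have p0 : p%:R != 0 :> R by rewrite pnatr_eq0 -lt0n prime_gt0.
rewrite -(sum_Fp_val (fun i => \1_B (i%:R / p%:R : R)) p_pr) /pair_mean exchange_big /=.
rewrite (eq_bigr (fun=> \sum_(a : 'F_p) \1_B (grid R a))); last first.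
  move=> b _; rewrite [RHS](reindex_inj (addIr (- b))).
  by apply: eq_bigr => a _; rewrite /diff_indic sub_mod1_grid.
by rewrite sumr_const card_Fp// -[X in X / _]mulr_natr; field.
Qed.

Section IntervalCount.
Variable B : set R.
Hypotheses (Bitv : is_interval B) (B01 : B `<=` `[0, 1]).

Let mB : measurable B := is_interval_measurable Bitv.

Let fin_muB : mu B \is a fin_num.
Proof.
rewrite ge0_fin_numE// (@le_lt_trans _ _ (mu `[0, 1]))//.
  by apply: le_measure; rewrite ?inE.
by rewrite lebesgue_measure_itv/= lte_fin ltr01 -EFinB ltry.
Qed.

Lemma interval_measure_ge (a b : R) : a <= b -> B a -> B b -> b - a <= fine (mu B).
Proof.
move=> ab Ba Bb; have -> : b - a = fine (mu `[a, b]).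
  rewrite lebesgue_measure_itv/= lte_fin.
  by move: ab; rewrite le_eqVlt => /predU1P[->|->]; rewrite ?ltxx ?subrr.
rewrite fine_le//; first by rewrite lebesgue_measure_itv/=; case: ifP.
apply: le_measure; rewrite ?inE// => x /=; rewrite in_itv/=.
exact: Bitv.
Qed.

Lemma interval_measure_le (a b : R) : a <= b -> B `<=` `[a, b] -> fine (mu B) <= b - a.
Proof.
move=> ab Bab; have -> : b - a = fine (mu `[a, b]).
  rewrite lebesgue_measure_itv/= lte_fin.
  by move: ab; rewrite le_eqVlt => /predU1P[->|->]; rewrite ?ltxx ?subrr.
rewrite fine_le//; first by rewrite lebesgue_measure_itv/=; case: ifP.
by apply: le_measure; rewrite ?inE.
Qed.

(** The points i / n in an interval are consecutive, and the interval contains the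
    hull of these points and exceeds it by at most one mesh on each side. *)
Lemma interval_count n : (0 < n)%N ->
  `|(\sum_(i < n) \1_B (i%:R / n%:R : R)) / n%:R - fine (mu B)| <= n%:R^-1.
Proof.
move=> n0; have n0R : 0 < n%:R :> R by rewrite ltr0n.
have n1 : n%:R^-1 >= 0 :> R by rewrite invr_ge0.
have nn : n%:R / n%:R = 1 :> R by rewrite divff ?lt0r_neq0.
pose P i := (i < n)%N && (i%:R / n%:R \in B).
have [exP|noP] := pselect (exists i, P i).
  have ubP i : P i -> (i <= n)%N by case/andP => /ltnW.
  case: (ex_minnP exP) => i0 /andP[i0n /set_mem Bi0] i0min.
  case: (ex_maxnP exP ubP) => i1 /andP[i1n /set_mem Bi1] i1max.
  have i01 : (i0 <= i1)%N by apply: i0min; rewrite /P i1n mem_set.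
  have -> : \sum_(i < n) \1_B (i%:R / n%:R : R) = (i1.+1 - i0)%:R :> R.
    transitivity (\sum_(0 <= i < n) (\1_B (i%:R / n%:R : R) : R)).
      by rewrite big_mkord.
    rewrite (big_cat_nat (leq0n i0) (ltnW i0n))/= (big_cat_nat (leqW i01) i1n)/=.
    rewrite big_nat_cond big1 => [|j /andP[/andP[_ ji] _]]; last first.
      rewrite indicE; case: (boolP (_ \in B)) => // jB.
      by have := i0min j; rewrite /P jB (ltn_trans ji)// => /(_ isT); rewrite leqNgt ji.
    rewrite [X in _ + (_ + X)]big_nat_cond [X in _ + (_ + X)]big1 =>
      [|j /andP[/andP[ij jn] _]]; last first.
      rewrite indicE; case: (boolP (_ \in B)) => // jB.
      by have := i1max j; rewrite /P jB jn => /(_ isT); rewrite leqNgt ij.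
    rewrite add0r addr0 big_nat_cond (eq_bigr (fun=> 1)) => [|j /andP[/andP[ij ji] _]].
      by rewrite -big_nat_cond sumr_const_nat.
    rewrite indicE mem_set//; apply: (Bitv Bi0 Bi1).
    by rewrite !ler_pM2r ?invr_gt0// !ler_nat ij -ltnS.
  have lo : i1%:R / n%:R - i0%:R / n%:R <= fine (mu B).
    by apply: interval_measure_ge; rewrite // ler_pM2r ?invr_gt0// ler_nat.
  have hi : fine (mu B) <= (i1%:R + 1) / n%:R - (i0%:R - 1) / n%:R.
    apply: interval_measure_le.
      rewrite ler_pM2r ?invr_gt0//; have : i0%:R <= i1%:R :> R by rewrite ler_nat.
      by move=> ?; lra.
    move=> x Bx; have := B01 Bx; rewrite /= !in_itv/= => /andP[x0 x1].
    apply/andP; split; rewrite leNgt; apply/negP => xlt.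
      case: (posnP i0) => [i00|i0gt].
        by move: xlt; rewrite i00 sub0r mulN1r; lra.
      have : P i0.-1.
        rewrite /P (leq_ltn_trans (leq_pred _))// mem_set//.
        apply: (Bitv Bx Bi0); rewrite ler_pM2r ?invr_gt0// ler_nat leq_pred andbT.
        by rewrite -subn1 natrB// ltW.
      by move=> /i0min; rewrite leqNgt ltn_predL i0gt.
    have i1n' : (i1.+1 < n)%N.
      rewrite -(ltr_nat R) -(ltr_pM2r (_ : 0 < n%:R^-1)) ?invr_gt0// nn -natr1.
      exact: lt_le_trans x1.
    have : P i1.+1.
      rewrite /P i1n' mem_set//; apply: (Bitv Bi1 Bx).
      by rewrite ler_pM2r ?invr_gt0// ler_nat leqnSn -natr1 ltW.
    by move=> /i1max; rewrite ltnn.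
  rewrite natrB ?(leqW i01)// -natr1.
  by rewrite ler_norml; move: lo hi; rewrite !mulrDl !mulNr; lra.
have noB i : (i < n)%N -> ~ B (i%:R / n%:R).
  by move=> iN Bi; apply: noP; exists i; rewrite /P iN mem_set.
rewrite big1 ?mul0r => [|i _]; last first.
  by rewrite indicE memNset//; exact: noB.
rewrite sub0r normrN ger0_norm ?fine_ge0//.
have [[x Bx]|B0] := pselect (exists x, B x); last first.
  rewrite (_ : B = set0) ?measure0//.
  by apply/seteqP; split => // x Bx; case: B0; exists x.
have := B01 Bx; rewrite /= in_itv/= => /andP[x0 x1].
pose i := minn (Num.truncn (x * n%:R)) n.-1.
have iN : (i < n)%N by rewrite /i; lia.
have /andP[tx xt] := truncn_itv (mulr_ge0 x0 (ltW n0R)).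
have ix : i%:R / n%:R <= x.
  by rewrite ler_pdivrMr// (le_trans _ tx)// ler_nat geq_minl.
have xi : x <= i.+1%:R / n%:R.
  rewrite ler_pdivlMr// /i; case: (leqP (Num.truncn (x * n%:R)) n.-1) => _;
    first exact: ltW.
  by rewrite prednK// ler_piMl.
rewrite (le_trans (@interval_measure_le (i%:R / n%:R) (i.+1%:R / n%:R) _ _))//.
- exact: le_trans xi.
- move=> y By; have := B01 By; rewrite /= !in_itv/= => /andP[y0 y1].
  apply/andP; split; rewrite leNgt; apply/negP => ylt.
    by apply: (noB i iN); apply: (Bitv By Bx); rewrite ix ltW.
  have iN' : (i.+1 < n)%N.
    rewrite -(ltr_nat R) -(ltr_pM2r (_ : 0 < n%:R^-1)) ?invr_gt0// nn.
    exact: lt_le_trans y1.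
  by apply: (noB _ iN'); apply: (Bitv Bx By); rewrite xi ltW.
- by rewrite -mulrBl -natr1 addrAC subrr add0r mul1r.
Qed.
End IntervalCount.

End Discrepancy.

(** * Upper discrepancy of the lagged differences *)

Section Discrepancy.
Variable R : realType.
Notation mu := (@lebesgue_measure R).

Lemma limn_sup_eq (u : nat -> R) (M l : R) : (forall n, `|u n| <= M) ->
  (forall e, 0 < e -> exists n0, forall n, (n0 <= n)%N -> u n <= l + e) ->
  (forall e n0, 0 < e -> exists2 n, (n0 <= n)%N & l - e <= u n) ->
  limn_sup u = l.
Proof.
move=> uM ule uge.
have bu : bounded_fun u.
  by exists M; split; [exact: num_real|move=> N MN n _;
    exact: le_trans (uM n) (ltW MN)].
have ubu n : has_ubound (sdrop u n) by apply/has_ubound_sdrop/bounded_fun_has_ubound.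
rewrite limn_supE//; apply/eqP; rewrite eq_le; apply/andP; split.
  apply/ler_addgt0Pr => e /ule[n0 un0].
  apply: (@le_trans _ _ (sups u n0)).
    by apply: ge_inf; [exact: bounded_fun_has_lbound_sups|exists n0].
  apply: ge_sup; first by exists (u n0), n0 => /=.
  by move=> _ [n /= n0n <-]; exact: un0.
apply/ler_addgt0Pr => e e0; rewrite -lerBlDr.
apply: lb_le_inf; first by exists (sups u 0%N), 0%N.
move=> _ [n0 _ <-]; have [n n0n un] := uge e n0 e0.
by apply: (le_trans un); apply: ub_le_sup => //; exists n.
Qed.

Notation lag_diff h := (fun n => sub_mod1 (staged_seq R (n + h)) (staged_seq R n)).

Lemma staged_seq_itv n : 0 <= staged_seq R n < 1.
Proof. exact: stage_word_itv. Qed.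

Lemma diff_indic_bounded B : bounded_on_square (@diff_indic R B) 1.
Proof. by move=> u v _ _; rewrite /diff_indic indicE; case: (_ \in _);
  rewrite ?normr1 ?normr0. Qed.

Lemma count_lag_diff (B : set R) h N :
  #|[set k : 'I_N | (lag_diff h) k \in B]|%:R / N%:R = lag_average (diff_indic B) h N.
Proof.
rewrite /lag_average -sum1_card natr_sum big_mkcond /=; congr (_ / _).
apply: eq_bigr => k _; rewrite /diff_indic indicE.
case: (boolP (_ \in B)) => kB.
  by rewrite mem_set.
by rewrite memNset//; exact/negP.
Qed.

(** The error on the diagonal part is at most 1, with a weight of about 1/2 at
    most, and the error on the other part is one mesh of the grid. *)
Lemma stage_mean_diff_indic (B : set R) h k : (0 < h)%N -> is_interval B -> B `<=`
  `[0, 1] ->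
  `|stage_mean (diff_indic B) h k - fine (mu B)| <= 1 / 2 + (h%:R + 1) / k.+1%:R.
Proof.
move=> h0 Bi B01; set m := fine _.
have p_pr := stage_prime_prime k; have p0 := prime_gt0 p_pr.
have p0R : 0 < (stage_prime k)%:R :> R by rewrite ltr0n.
have kp : (stage_prime k)%:R^-1 <= k.+1%:R^-1 :> R.
  by rewrite lef_pV2 ?posrE// ler_nat stage_prime_gt.
have m0 : 0 <= m by rewrite fine_ge0.
have m1 : m <= 1.
  by rewrite (le_trans (interval_measure_le Bi B01 ler01 B01))// subr0.
have G2 := interval_count Bi B01 p0; rewrite -pair_mean_diff_indic// -/m in G2.
have G1 : `|diag_mean (diff_indic B) (stage_prime k) - m| <= 1.
  rewrite diag_mean_diff_indic// indicE ler_norml.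
  by case: (_ \in _) => /=; lra.
have /andP[r0 r1] := overlap_ratio_itv R h k.
have r2 : overlap_ratio R h k <= 1 / 2 + h%:R / k.+1%:R.
  rewrite /overlap_ratio; have [hd|hd] := eqVneq h (stage_shift k); last first.
    by rewrite overlap_other// mul0r addr_ge0 ?divr_ge0.
  have := overlap_same p_pr h0; rewrite -hd => /andP[_ le2].
  have : (overlap (stage_prime k) h h)%:R * 2 <= (stage_prime k)%:R + h%:R :> R.
    by rewrite -natrM -natrD ler_nat muln2.
  rewrite -(ler_pM2r (_ : 0 < (stage_prime k)%:R^-1)) ?invr_gt0//
    mulrDl divff ?lt0r_neq0// mulrAC.
  have : h%:R * (stage_prime k)%:R^-1 <= h%:R / k.+1%:R :> R by rewrite ler_wpM2l.
  have : 0 <= h%:R / k.+1%:R :> R by rewrite divr_ge0.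
  move: (h%:R / (stage_prime k)%:R : R) (h%:R / k.+1%:R : R) => a b.
  by move: ((overlap _ _ _)%:R / _ : R) => c *; lra.
rewrite /stage_mean; move: r0 r1 r2 G1 G2.
move: (overlap_ratio _ _ _) (diag_mean _ _) (pair_mean _ _) => r a b r0 r1 r2 G1 G2.
have -> : r * a + (1 - r) * b - m = r * (a - m) + (1 - r) * (b - m) by ring.
rewrite (le_trans (ler_normD _ _))// !normrM (ger0_norm r0) (@ger0_norm _ (1 -
  r)) ?subr_ge0//.
have H1 : r * `|a - m| <= r * 1 by rewrite ler_wpM2l.
have H2 : (1 - r) * `|b - m| <= 1 * k.+1%:R^-1.
  by apply: ler_pM; rewrite ?subr_ge0// ?(le_trans G2)//; lra.
rewrite (le_trans (lerD H1 H2))// mulr1 mul1r.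
have -> : (h%:R + 1) / k.+1%:R = h%:R / k.+1%:R + k.+1%:R^-1 :> R by rewrite mulrDl
  mul1r.
by rewrite addrA lerD2r.
Qed.

Lemma stage_weight_itv N : (0 < stage N)%N -> 0 <= stage_weight R N <= 1.
Proof.
move=> s0; have /andP[sN _] := stageP N.
have N0 : (0 < N)%N by apply: leq_trans sN; apply: leq_trans (stage_start_ge _).
by rewrite divr_ge0//= ler_pdivrMr ?ltr0n// mul1r ler_nat.
Qed.

Lemma lag_average_diff_indic (B : set R) h N : (0 < h)%N -> is_interval B -> B `<=`
  `[0, 1] ->
  (0 < stage N)%N ->
  `|lag_average (diff_indic B) h N - fine (mu B)| <= 1 / 2 + (7 * h%:R + 5) / (stage
    N)%:R.
Proof.
move=> h0 Bi B01 s0; set k := (stage N).-1.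
have sk : stage N = k.+1 by rewrite /k prednK.
have approx := lag_average_approx h (@diff_indic_bounded B) s0.
rewrite -/k in approx; set l := stage_weight R N in approx.
have kk : k.+2%:R^-1 <= k.+1%:R^-1 :> R by rewrite lef_pV2 ?posrE// ler_nat.
have cvx : `|l * stage_mean (diff_indic B) h k + (1 -
  l) * stage_mean (diff_indic B) h (stage N) - fine (mu B)|
    <= 1 / 2 + (h%:R + 1) / k.+1%:R.
  apply: convex_dist; first exact: stage_weight_itv.
    exact: stage_mean_diff_indic.
  rewrite sk (le_trans (stage_mean_diff_indic _ h0 Bi B01))// lerD2l ler_wpM2l//.
set A := l * _ + _ in approx cvx.
have -> : lag_average (diff_indic B) h N - fine (mu B)
    = (lag_average (diff_indic B) h N - A) + (A - fine (mu B)) by ring.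
rewrite (le_trans (ler_normD _ _))// (le_trans (lerD approx cvx))//.
rewrite sk mul1r addrCA lerD2l -mulrDl ler_wpM2r ?invr_ge0//.
by have := ler0n R h; lra.
Qed.

Definition discrepancy_values (z : nat -> R) N : set R :=
  [set `| #|[set k : 'I_N | z k \in B]|%:R / N%:R - fine (mu B)|
      | B in [set B : set R | is_interval B /\ B `<=` @unit_interval R]].

Lemma lag_average_diff_indic_itv (B : set R) h N : 0 <= lag_average (diff_indic B) h N
  <= 1.
Proof.
rewrite /lag_average; case: N => [|N]; first by rewrite big_ord0 mul0r ler01 lexx.
apply/andP; split; first by rewrite divr_ge0// sumr_ge0// => n _;
  rewrite /diff_indic indicE.
rewrite ler_pdivrMr// mul1r -[leRHS](_ : \sum_(n < N.+1) 1 = _); last first.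
  by rewrite sumr_const card_ord.
by apply: ler_sum => n _; rewrite /diff_indic indicE lern1 leq_b1.
Qed.

Lemma discrepancy_ub h N : ubound (discrepancy_values (lag_diff h) N) 1.
Proof.
move=> _ /= [B [Bi B01] <-]; rewrite count_lag_diff.
have := lag_average_diff_indic_itv B h N.
have m0 : 0 <= fine (mu B) by rewrite fine_ge0.
have m1 : fine (mu B) <= 1.
  by rewrite (le_trans (interval_measure_le Bi B01 ler01 B01))// subr0.
by rewrite ler_norml => /andP[]; lra.
Qed.

Lemma discrepancy_values_neq0 z N : discrepancy_values z N !=set0.
Proof. by eexists; exists set0 => //; split. Qed.

Lemma upper_discrepancy_lag_diff h : (0 < h)%N ->
  upper_discrepancy (lag_diff h) = 1 / 2.
Proof.
move=> h0; apply: (@limn_sup_eq _ 1).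
- move=> N; rewrite ger0_norm.
    exact: ge_sup (discrepancy_values_neq0 _ N) (@discrepancy_ub h N).
  have := @discrepancy_ub h N; have [x Dx] := discrepancy_values_neq0 (lag_diff h) N.
  move=> ub; apply: (@le_trans _ _ x); last by apply: ub_le_sup Dx; exists 1.
  by case: Dx => B _ <-.
- move=> e e0; pose s := (Num.truncn ((7 * h%:R + 5) / e)).+1.
  exists (stage_start s) => N; rewrite -stage_le => sN.
  have s0 : (0 < stage N)%N by apply: leq_trans sN.
  apply: (ge_sup (discrepancy_values_neq0 _ N)).
  move=> _ /= [B [Bi B01] <-]; rewrite count_lag_diff.
  rewrite (le_trans (lag_average_diff_indic h0 Bi B01 s0))// lerD2l.
  rewrite ler_pdivrMr ?ltr0n// [leRHS]mulrC -ler_pdivrMr//.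
  by rewrite (le_trans (ltW (truncnS_gt _)))// ler_nat.
- move=> e n0 e0; pose s := (Num.truncn ((6 * h%:R + 4) / e)).+1.
  (* A late stage whose shift is h. *)
  pose j := (2 ^ h * (n0 + s).*2.+1)%N.
  have jd : stage_shift j = h.
    rewrite /stage_shift lognM ?expn_gt0// pfactorK// lognE/=.
    by rewrite dvdn2 /= odd_double /= addn0.
  have jge : (n0 + s <= j)%N.
    by rewrite /j (leq_trans _ (leq_pmull _ _)) ?expn_gt0//; lia.
  pose N := stage_start j.+1.
  have jN : (j < N)%N := stage_start_ge _.
  have sN : stage N = j.+1 by apply: stage_eq; rewrite leqnn stage_start_lt.
  exists N; first by lia.
  have N0 : N%:R != 0 :> R by rewrite pnatr_eq0 -lt0n; lia.
  have s0 : (0 < stage N)%N by rewrite sN.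
  have approx := lag_average_approx h (@diff_indic_bounded [set 0]) s0.
  rewrite /stage_weight sN /= -/N divff// subrr mul0r addr0 mul1r in approx.
  (* At the end of stage j the interval [0, 0] has frequency about 1/2. *)
  have zero_itv : is_interval [set 0 : R] by rewrite -set_itv1;
    exact: interval_is_interval.
  have zero01 : [set 0 : R] `<=` `[0, 1] by move=> _ ->;
    rewrite /= in_itv /= lexx ler01.
  apply: (@le_trans _ _ (`|lag_average (diff_indic [set 0 : R]) h N|)); last first.
    apply: ub_le_sup; first by exists 1; exact: discrepancy_ub.
    exists [set 0 : R]; first by split.
    by rewrite count_lag_diff lebesgue_measure_set1 subr0.
  apply: le_trans (ler_norm _).
  have half : 1 / 2 <= stage_mean (diff_indic [set 0 : R]) h j.
    have p_pr := stage_prime_prime j.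
    have /andP[r0 r1] := overlap_ratio_itv R h j.
    have r2 : 1 / 2 <= overlap_ratio R h j.
      rewrite /overlap_ratio jd ler_pdivlMr ?ltr0n ?prime_gt0//.
      have := overlap_same p_pr h0 => /andP[+ _].
      by rewrite -(ler_nat R) -muln2 natrM; lra.
    rewrite /stage_mean diag_mean_diff_indic// indicE mem_set// mulr1.
    apply: (le_trans r2); rewrite lerDl mulr_ge0 ?subr_ge0//.
    apply: divr_ge0; last exact: exprn_ge0.
    by do 2!(apply: sumr_ge0 => ? _); rewrite /diff_indic indicE.
  have : (4 + 6 * h%:R) / j.+1%:R <= e.
    rewrite ler_pdivrMr ?ltr0n// [leRHS]mulrC -ler_pdivrMr// addrC.
    by rewrite (le_trans (ltW (truncnS_gt _)))// ler_nat -/s leqW//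
      (leq_trans _ jge)// leq_addl.
  move: approx; rewrite ler_norml => /andP[+ _].
  move: half; rewrite !mul1r.
  by move: (stage_mean _ _ _) (lag_average _ _ _) (_ / j.+1%:R) => a b c *; lra.
Qed.

End Discrepancy.

(** * Correlations along prefixes *)

Lemma cvgny_stage_prime : stage_prime @ \oo --> \oo.
Proof.
apply/cvgnyPge => A; near=> k; rewrite (leq_trans _ (ltnW (stage_prime_gt k)))//.
by near: k; exact: nbhs_infty_ge.
Unshelve. all: by end_near. Qed.

Lemma cvgny_stage : stage @ \oo --> \oo.
Proof.
apply/cvgnyPge => A; near=> N; rewrite stage_le.
by near: N; exact: nbhs_infty_ge.
Unshelve. all: by end_near. Qed.

Section StageLimits.
Variable R : realType.
Notation mu := (@lebesgue_measure R).

(** The two last stages met by the first N terms, weighted by the shares of these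
    terms that they contain; still earlier stages are counted with the first one. *)
Definition stage_blend (w : nat -> R) (N : nat) : R :=
  stage_weight R N * w (stage N).-1 + (1 - stage_weight R N) * w (stage N).

Lemma lag_average_cvg g M h (w : nat -> R) : bounded_on_square g M ->
  (fun k => stage_mean g h k - w k) @ \oo --> (0 : R) ->
  (fun N => lag_average g h N - stage_blend w N) @ \oo --> (0 : R).
Proof.
move=> gM ew; apply/cvgrPdist_le => e e0.
have e20 : 0 < e / 2 by rewrite divr_gt0.
move/cvgrPdist_le : ew => /(_ _ e20) [k0 _ wk0].
have near_stage (P : set nat) : (\forall s \near \oo, P s) ->
  \forall N \near \oo, P (stage N) := @cvgny_stage P.
near=> N.
have sN : (0 < stage N)%N by near: N; exact: near_stage (nbhs_infty_gt 0).
have k0N : (k0 < stage N)%N by near: N; exact: near_stage (nbhs_infty_gt k0).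
have approx := lag_average_approx h gM sN.
have err : M * (4 + 6 * h%:R) / (stage N)%:R <= e / 2.
  rewrite ler_pdivrMr ?ltr0n// [leRHS]mulrC -ler_pdivrMr//.
  by near: N; exact: near_stage (nbhs_infty_ger _).
pose d k := stage_mean g h k - w k.
have dk k : (k0 <= k)%N -> `|d k - 0| <= e / 2.
  by move=> /wk0; rewrite subr0 sub0r normrN.
have cvx : `|stage_weight R N * d (stage N).-1 + (1 -
  stage_weight R N) * d (stage N) - 0| <= e / 2.
  apply: convex_dist; first exact: stage_weight_itv.
    by apply: dk; lia.
  by apply: dk; lia.
rewrite sub0r normrN [leRHS]splitr.
apply: le_trans (lerD (le_trans approx err) cvx).
apply: le_trans (ler_normD _ _); rewrite le_eqVlt /stage_blend /d.
by apply/orP; left; apply/eqP; congr (`|_|); ring.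
Unshelve. all: by end_near. Qed.

(** Asymptotic proportion of the n < N for which the terms of index n + h and n
    are repetitions of each other. *)
Definition lag_coef h : nat -> R := stage_blend (overlap_ratio R h).

Lemma lag_coef0 N : lag_coef 0 N = 1.
Proof.
have o1 k : overlap_ratio R 0 k = 1.
  by rewrite /overlap_ratio overlap0 divff// pnatr_eq0 -lt0n prime_gt0//
    stage_prime_prime.
by rewrite /lag_coef /stage_blend !o1; ring.
Qed.

Lemma overlap_ratio_neq0 h k : (0 < h)%N -> overlap_ratio R h k != 0 -> h =
  stage_shift k.
Proof.
move=> h0; apply: contraNeq => hk.
by rewrite /overlap_ratio overlap_other// mul0r.
Qed.

(** The coefficient only depends on the shifts of two consecutive stages, one of
    which is 0. *)
Lemma lag_coef_disjoint h h' N : (0 < h)%N -> (0 < h')%N -> h != h' ->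
  lag_coef h N * lag_coef h' N = 0.
Proof.
move=> h0 h'0 hh'; apply/eqP; rewrite mulf_eq0; apply: contraNT hh'.
rewrite negb_or => /andP[]; set k := (stage N).-1.
have split_blend i : (0 < i)%N -> lag_coef i N != 0 ->
    (i == stage_shift k) || (i == stage_shift k.+1) && (0 < stage N)%N.
  move=> i0; apply: contraNT; rewrite negb_or negb_and -leqNgt leqn0.
  move=> /andP[ik ik1]; rewrite /lag_coef /stage_blend -/k.
  have rk : overlap_ratio R i k = 0 by apply: contraNeq ik => /overlap_ratio_neq0 ->.
  rewrite rk mulr0 add0r; have [s0|s0] := posnP (stage N).
    by rewrite (_ : stage N = k) ?rk ?mulr0// /k s0.
  rewrite -(prednK s0) -/k.
  have -> : overlap_ratio R i k.+1 = 0; last by rewrite mulr0.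
  apply: contraTeq ik1 => /overlap_ratio_neq0 <-//.
  by rewrite eqxx /= -lt0n s0.
have one_zero : (stage_shift k == 0)%N || (stage_shift k.+1 == 0)%N.
  have odd_shift m : odd m -> stage_shift m = 0%N.
    by move=> om; rewrite /stage_shift lognE dvdn2 om andbF.
  have [ok|ek] := boolP (odd k); first by rewrite odd_shift.
  by rewrite (odd_shift k.+1) ?orbT.
move=> /(split_blend h h0) hk /(split_blend h' h'0) h'k.
by move: one_zero hk h'k h0 h'0; lia.
Qed.

Section RealParts.
Variables (a b : R -> R) (M : R).
Hypotheses (a_cont : {within `[0, 1], continuous a})
  (b_cont : {within `[0, 1], continuous b})
  (aM : forall x : R, 0 <= x <= 1 -> `|a x| <= M)
  (bM : forall x : R, 0 <= x <= 1 -> `|b x| <= M)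
  (a_mean0 : \int[mu]_(x in `[0, 1]) a x = 0)
  (b_mean0 : \int[mu]_(x in `[0, 1]) b x = 0).

(** Real and imaginary parts of f(u) times the conjugate of f(v), for f = a + i b. *)
Definition re_corr u v : R := a u * a v + b u * b v.
Definition im_corr u v : R := b u * a v - a u * b v.

Definition energy : R := \int[mu]_(x in `[0, 1]) (a x * a x + b x * b x).

Let prime_mean (f : R -> R) k : R :=
  (\sum_(x : 'F_(stage_prime k)) f (grid R x)) / (stage_prime k)%:R.

Let prime_mean_cvg (f : R -> R) : {within `[0, 1], continuous f} ->
  prime_mean f @ \oo --> \int[mu]_(x in `[0, 1]) f x.
Proof.
move=> /riemann_sum fc.
have -> : prime_mean f =
   (fun n => (\sum_(i < n) f (i%:R / n%:R)) / n%:R) \o stage_prime.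
  apply/funext => k; rewrite /prime_mean /=.
  by rewrite -(sum_Fp_val (fun i => f (i%:R / (stage_prime k)%:R)) (stage_prime_prime
    k)).
exact: cvg_comp cvgny_stage_prime fc.
Qed.

Let zero01 (x : R) : 0 <= x < 1 -> 0 <= x <= 1.
Proof. by move=> /andP[-> /ltW]. Qed.

Let corr_bound (s t : R) : `|s| <= M * M -> `|t| <= M * M -> `|s + t| <= 2 * (M * M).
Proof.
move=> sM tM; rewrite (le_trans (ler_normD _ _))//.
by rewrite mulr_natl mulr2n lerD.
Qed.

Let prodM (f g : R -> R) u v : (forall x : R, 0 <= x <= 1 -> `|f x| <= M) ->
  (forall x : R, 0 <= x <= 1 -> `|g x| <= M) ->
  0 <= u < 1 -> 0 <= v < 1 -> `|f u * g v| <= M * M.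
Proof.
move=> fM gM u1 v1; rewrite normrM; apply: ler_pM => //.
  exact/fM/zero01.
exact/gM/zero01.
Qed.

Let product_mean (f g : R -> R) p :
  (\sum_(x : 'F_p) \sum_(y : 'F_p) f (grid R x) * g (grid R y)) / p%:R ^+ 2 =
  (\sum_(x : 'F_p) f (grid R x)) / p%:R * ((\sum_(x : 'F_p) g (grid R x)) / p%:R).
Proof. by rewrite -big_distrlr /= expr2 invfM; ring. Qed.

(** The uniform part of the pair average factors into the squares of the means of
    a and b, which are 0; only the diagonal part survives. *)
Lemma re_corr_cvg h :
  (fun N => lag_average re_corr h N - lag_coef h N * energy) @ \oo --> (0 : R).
Proof.
have bd : bounded_on_square re_corr (2 * (M * M)).
  by move=> u v u1 v1; apply: corr_bound; apply: prodM.
pose w k := overlap_ratio R h k * energy.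
have -> : (fun N => lag_average re_corr h N - lag_coef h N * energy) =
    (fun N => lag_average re_corr h N - stage_blend w N).
  by apply/funext => N; rewrite /lag_coef /stage_blend /w; ring.
apply: lag_average_cvg bd _.
have E k : stage_mean re_corr h k - w k =
   overlap_ratio R h k * (prime_mean (fun x => a x * a x + b x * b x) k - energy)
   + (1 - overlap_ratio R h k)
     * (prime_mean a k * prime_mean a k + prime_mean b k * prime_mean b k).
  have -> : stage_mean re_corr h k = overlap_ratio R h k * prime_mean (fun x =>
    a x * a x + b x * b x) k
      + (1 - overlap_ratio R h k) * pair_mean re_corr (stage_prime k) by [].
  have -> : pair_mean re_corr (stage_prime k) =
      prime_mean a k * prime_mean a k + prime_mean b k * prime_mean b k.
    rewrite /pair_mean /re_corr; under eq_bigr do rewrite big_split /=.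
    by rewrite big_split /= mulrDl (product_mean a a) (product_mean b b).
  by rewrite /w; ring.
under eq_fun do rewrite E.
have a0 := prime_mean_cvg a_cont; rewrite a_mean0 in a0.
have b0 := prime_mean_cvg b_cont; rewrite b_mean0 in b0.
have sq_cont : {within `[0, 1], continuous (fun x => a x * a x + b x * b x)}.
  by move=> x; apply: cvgD; apply: cvgM; (exact: a_cont || exact: b_cont).
have D0 : (fun k => prime_mean (fun x => a x * a x + b x * b x) k -
  energy) @ \oo --> (0 : R).
  by rewrite -(subrr energy); apply: cvgB; [exact: prime_mean_cvg|exact: cvg_cst].
have P0 : (fun k => prime_mean a k * prime_mean a k + prime_mean b k * prime_mean b k)
    @ \oo --> (0 : R).
  by have := cvgD (cvgM a0 a0) (cvgM b0 b0); rewrite mulr0 addr0; apply.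
apply/cvgrPdist_le => e e0.
move/cvgrPdist_le : D0 => /(_ e e0) D0; move/cvgrPdist_le : P0 => /(_ e e0) P0.
near=> k; rewrite distrC; apply: convex_dist; first exact: overlap_ratio_itv.
  by rewrite distrC; near: k.
by rewrite distrC; near: k.
Unshelve. all: by end_near. Qed.

(** The integrand is antisymmetric in (u, v), so its averages over the grid and
    over the diagonal are exactly 0. *)
Lemma im_corr_cvg h : lag_average im_corr h @ \oo --> (0 : R).
Proof.
have bd : bounded_on_square im_corr (2 * (M * M)).
  by move=> u v u1 v1; apply: corr_bound; rewrite ?normrN; apply: prodM.
have -> : lag_average im_corr h =
    (fun N => lag_average im_corr h N - stage_blend (fun=> 0) N).
  by apply/funext => N; rewrite /stage_blend; ring.
apply: lag_average_cvg bd _.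
have E k : stage_mean im_corr h k - 0 = 0.
  have diag0 : diag_mean im_corr (stage_prime k) = 0.
    by rewrite /diag_mean big1 ?mul0r// => x _; rewrite /im_corr; ring.
  have pair0 : pair_mean im_corr (stage_prime k) = 0.
    rewrite /pair_mean /im_corr; under eq_bigr do rewrite sumrB.
    by rewrite sumrB mulrBl (product_mean b a) (product_mean a b) mulrC subrr.
  by rewrite /stage_mean diag0 pair0; ring.
under eq_fun do rewrite E.
exact: cvg_cst.
Qed.

End RealParts.
End StageLimits.

(** * Complex numbers through real and imaginary parts *)

Section Complex.
Variable R : realType.
Notation mu := (@lebesgue_measure R).
Implicit Types z w : R[i].

Lemma ReD z w : complex.Re (z + w) = complex.Re z + complex.Re w.
Proof. by case: z; case: w. Qed.

Lemma ImD z w : complex.Im (z + w) = complex.Im z + complex.Im w.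
Proof. by case: z; case: w. Qed.

Lemma ReB z w : complex.Re (z - w) = complex.Re z - complex.Re w.
Proof. by case: z; case: w. Qed.

Lemma ImB z w : complex.Im (z - w) = complex.Im z - complex.Im w.
Proof. by case: z; case: w. Qed.

Lemma complex_ext z w : complex.Re z = complex.Re w -> complex.Im z = complex.Im w ->
  z = w.
Proof. by case: z => a b; case: w => c d /= -> ->. Qed.

Lemma normC_le_ReIm z : `|z| <= (`|complex.Re z| + `|complex.Im z|)%:C%C.
Proof.
rewrite normc_def lecR -[leRHS]ger0_norm ?addr_ge0// -sqrtr_sqr.
rewrite ler_wsqrtr// sqrrD !real_normK ?num_real// lerD2r lerDl.
by rewrite mulrn_wge0// mulr_ge0.
Qed.

Lemma Re_le_normc z (e : R) : `|z| <= e%:C%C -> `|complex.Re z| <= e.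
Proof. by move=> ze; rewrite -lecR (le_trans _ ze)// normc_ge_Re. Qed.

Lemma Im_le_normc z (e : R) : `|z| <= e%:C%C -> `|complex.Im z| <= e.
Proof.
move=> ze; rewrite -lecR (le_trans _ ze)// normc_def lecR -sqrtr_sqr.
by rewrite ler_wsqrtr// lerDr sqr_ge0.
Qed.

Lemma cvg_complexP (T : Type) (F : set_system T) (FF : Filter F) (u : T -> R[i]) (l :
  R[i]) :
  u @ F --> l <->
  ((fun t => complex.Re (u t)) @ F --> complex.Re l) /\
  ((fun t => complex.Im (u t)) @ F --> complex.Im l).
Proof.
split=> [/cvgrPdist_le ul|[/cvgrPdist_le rl /cvgrPdist_le il]].
  split; apply/cvgrPdist_le => e e0.
    have := ul (e%:C%C); rewrite ltcR => /(_ e0); apply: filterS => t.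
    by move=> /Re_le_normc; rewrite ReB.
  have := ul (e%:C%C); rewrite ltcR => /(_ e0); apply: filterS => t.
  by move=> /Im_le_normc; rewrite ImB.
apply/cvgrPdist_le => e; rewrite ltcE /= => /andP[/eqP ei e0].
have e2 : 0 < complex.Re e / 2 by rewrite divr_gt0.
have -> : e = (complex.Re e)%:C%C by apply: complex_ext.
near=> t; rewrite (le_trans (normC_le_ReIm _))// lecR ReB ImB [leRHS]splitr.
apply: lerD; near: t; [exact: rl|exact: il].
Unshelve. all: by end_near. Qed.

Lemma correlation_lag_average (f : R -> R[i]) h n :
  correlation (fun k => f (staged_seq R k)) h n =
  Complex
    (lag_average (re_corr (fun t => complex.Re (f t)) (fun t => complex.Im (f t))) h n)
    (lag_average (im_corr (fun t => complex.Re (f t)) (fun t => complex.Im (f t))) h n).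
Proof.
have scale (S : R[i]) : n%:R^-1 * S = Complex (complex.Re S / n%:R) (complex.Im S /
  n%:R).
  rewrite -(rmorph_nat (real_complex R)) -fmorphV; case: S => a b.
  by apply: complex_ext => /=; ring.
rewrite /correlation scale /lag_average; congr (Complex (_ / _) (_ / _)).
  rewrite (big_morph _ ReD (erefl _)); apply: eq_bigr => k _; rewrite /re_corr /=.
  by case: (f _) => a b; case: (f _) => c d /=; ring.
rewrite (big_morph _ ImD (erefl _)); apply: eq_bigr => k _; rewrite /im_corr /=.
by case: (f _) => a b; case: (f _) => c d /=; ring.
Qed.

Lemma within_continuous_Re (f : R -> R[i]) (A : set R) :
  {within A, continuous f} -> {within A, continuous (fun t => complex.Re (f t))}.
Proof. by move=> fc x; have /cvg_complexP[] := fc x. Qed.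

Lemma within_continuous_Im (f : R -> R[i]) (A : set R) :
  {within A, continuous f} -> {within A, continuous (fun t => complex.Im (f t))}.
Proof. by move=> fc x; have /cvg_complexP[] := fc x. Qed.

Lemma continuous_bounded (f : R -> R) : {within `[0, 1], continuous f} ->
  exists M, forall x : R, 0 <= x <= 1 -> `|f x| <= M.
Proof.
move=> fc; have /compact_bounded[M [_ Mf]] :=
  continuous_compact fc (@segment_compact _ _ _).
exists (M + 1) => x x01; apply: (Mf (M + 1)); first by rewrite ltrDl.
by exists x; rewrite //= in_itv.
Qed.

End Complex.

(** * Orthogonality of the characters *)

Section TrigIntegrals.
Variable R : realType.
Notation mu := (@lebesgue_measure R).

Lemma Rintegral_antiderivative (f F : R -> R) : continuous f ->
  (forall x : R, is_derive x 1 F (f x)) ->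
  \int[mu]_(t in `[0, 1]) f t = F 1 - F 0.
Proof.
move=> fc dF.
have Fc : continuous F.
  by move=> x; apply: differentiable_continuous; apply/derivable1_diffP;
    exact: ex_derive.
rewrite /Rintegral (@continuous_FTC2 _ f F 0 1)//.
- exact: continuous_subspaceT.
- split=> [x _| |]; first exact: ex_derive.
  + exact/cvg_at_right_filter/Fc.
  + exact/cvg_at_left_filter/Fc.
- by move=> x _; rewrite derive1E; exact: derive_val.
Qed.

Lemma unit_measure : fine (mu `[0, 1]) = 1.
Proof. by rewrite lebesgue_measure_itv/= lte_fin ltr01 oppr0 adde0. Qed.

Lemma phase0 (t : R) : 2 * pi * ((0 : int)%:~R * t) = 0 :> R.
Proof. by rewrite mul0r mulr0. Qed.

Lemma phase_continuous (c : R) : continuous (fun t : R => 2 * pi * (c * t)).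
Proof. by move=> t; apply: cvgMr; apply: cvgMr; exact: cvg_id. Qed.

Lemma is_derive_phase (c x : R) : is_derive x 1 (fun t : R =>
  2 * pi * (c * t)) (2 * pi * c).
Proof. by apply: is_derive_eq; rewrite /GRing.scale /=; ring. Qed.

Lemma sincos_2pi_nat n : sin (2 * pi * n%:R) = 0 :> R /\ cos (2 * pi * n%:R) = 1 :> R.
Proof.
have -> : 2 * pi * n%:R = 0 + (pi *+ 2) *+ n :> R by rewrite add0r mulr_natr mulr_natl.
by rewrite (periodicn (@sinD2pi R)) (periodicn (@cosD2pi R)) sin0 cos0.
Qed.

Lemma sin_2pi_int (m : int) : sin (2 * pi * m%:~R) = 0 :> R.
Proof.
case: m => n; first by have [] := sincos_2pi_nat n.
by rewrite NegzE mulrNz mulrN sinN; have [-> _] := sincos_2pi_nat n.+1; rewrite oppr0.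
Qed.

Lemma cos_2pi_int (m : int) : cos (2 * pi * m%:~R) = 1 :> R.
Proof.
case: m => n; first by have [] := sincos_2pi_nat n.
by rewrite NegzE mulrNz mulrN cosN; have [_ ->] := sincos_2pi_nat n.+1.
Qed.

Lemma integral_cos (m : int) :
  \int[mu]_(t in `[0, 1]) cos (2 * pi * (m%:~R * t)) = (m == 0)%:R.
Proof.
have [->|m0] := eqVneq m 0.
  under eq_Rintegral do rewrite phase0 cos0.
  by rewrite Rintegral_cst// mul1r unit_measure.
have c0 : 2 * pi * m%:~R != 0 :> R.
  by rewrite !mulf_neq0// ?intr_eq0// lt0r_neq0// pi_gt0.
have dF (x : R) : is_derive x 1 (fun t => (2 * pi * m%:~R)^-1 * sin (2 * pi * (m%:~R *
  t)))
    (cos (2 * pi * (m%:~R * x))).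
  have ds := is_derive1_comp (is_derive_sin _) (is_derive_phase m%:~R x).
  by apply: (is_derive_eq (is_deriveZ _ ds));
    rewrite /GRing.scale /= mulrCA mulVf// mulr1.
rewrite (Rintegral_antiderivative _ dF).
  by rewrite !mulr0 sin0 mulr1 sin_2pi_int mulr0 subr0.
by move=> x; apply: continuous_comp; [exact: phase_continuous|exact: continuous_cos].
Qed.

Lemma integral_sin (m : int) :
  \int[mu]_(t in `[0, 1]) sin (2 * pi * (m%:~R * t)) = 0.
Proof.
have [->|m0] := eqVneq m 0.
  under eq_Rintegral do rewrite phase0 sin0.
  by rewrite Rintegral_cst// mul0r.
have c0 : 2 * pi * m%:~R != 0 :> R.
  by rewrite !mulf_neq0// ?intr_eq0// lt0r_neq0// pi_gt0.
have dF (x : R) : is_derive x 1 (fun t => -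
  (2 * pi * m%:~R)^-1 * cos (2 * pi * (m%:~R * t)))
    (sin (2 * pi * (m%:~R * x))).
  have dc := is_derive1_comp (is_derive_cos _) (is_derive_phase m%:~R x).
  by apply: (is_derive_eq (is_deriveZ _ dc));
    rewrite /GRing.scale /= mulrCA !mulNr mulVf// mulrN1 opprK.
rewrite (Rintegral_antiderivative _ dF).
  by rewrite !mulr0 cos0 mulr1 cos_2pi_int subrr.
by move=> x; apply: continuous_comp; [exact: phase_continuous|exact: continuous_sin].
Qed.
End TrigIntegrals.

(** * The limit correlations are Fourier coefficients *)

Section Spectral.
Variable R : realType.
Notation mu := (@lebesgue_measure R).

(** The trigonometric polynomial V + c e^(-2 pi i h0 t).  A single complex
    exponential suffices because only the coefficients at h >= 0 are prescribed. *)
Definition density (V c : R) (h0 : nat) (t : R) : R[i] :=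
  Complex (V + c * cos (2 * pi * (h0%:R * t))) (- (c * sin (2 * pi * (h0%:R * t)))).

Let cos_cont (c : R) : continuous (fun t : R => cos (2 * pi * (c * t))).
Proof. by move=> x; apply: continuous_comp;
  [exact: phase_continuous|exact: continuous_cos]. Qed.

Let sin_cont (c : R) : continuous (fun t : R => sin (2 * pi * (c * t))).
Proof. by move=> x; apply: continuous_comp;
  [exact: phase_continuous|exact: continuous_sin]. Qed.

Let integrable_cont (g : R -> R) : continuous g -> mu.-integrable `[0, 1] (EFin \o g).
Proof.
move=> gc; apply: continuous_compact_integrable; first exact: segment_compact.
exact: continuous_subspaceT.
Qed.

Let scale_cont c (g : R -> R) : continuous g -> continuous (fun t => c * g t).
Proof. by move=> gc x; apply: cvgMr; exact: gc. Qed.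

Lemma density_L1 V c h0 : L1 (density V c h0).
Proof.
split; apply: integrable_cont => x /=.
  by apply: cvgD; [exact: cvg_cst|apply: scale_cont; exact: cos_cont].
by apply: cvgN; apply: scale_cont; exact: sin_cont.
Qed.

Lemma density_coef V c h0 h :
  cintegral (fun t => density V c h0 t * e2pi (h%:R * t)) =
  Complex (V * (h == 0%N)%:R + c * (h == h0)%:R) 0.
Proof.
pose m : int := h%:Z - h0%:Z.
have hE : h%:R = (h%:Z)%:~R :> R by [].
have mE : h%:R - h0%:R = m%:~R :> R by rewrite /m rmorphB.
have m0 : (m == 0) = (h == h0) by rewrite /m subr_eq0 eqz_nat.
have phase t : 2 * pi * (m%:~R * t) = 2 * pi * (h%:R * t) - 2 * pi * (h0%:R * t) :> R.
  by rewrite -mE; ring.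
rewrite /cintegral; congr Complex.
  transitivity (\int[mu]_(t in `[0, 1]) (V * cos (2 * pi * ((h%:Z)%:~R * t))
      + c * cos (2 * pi * (m%:~R * t)))).
    apply: eq_Rintegral => t _; rewrite phase cosB /=; ring.
  rewrite RintegralD//; try exact/integrable_cont/scale_cont/cos_cont.
  by rewrite !RintegralZl ?integral_cos ?m0//; exact/integrable_cont/cos_cont.
transitivity (\int[mu]_(t in `[0, 1]) (V * sin (2 * pi * ((h%:Z)%:~R * t))
      + c * sin (2 * pi * (m%:~R * t)))).
  apply: eq_Rintegral => t _; rewrite phase sinB /=; ring.
rewrite RintegralD//; try exact/integrable_cont/scale_cont/sin_cont.
by rewrite !RintegralZl ?integral_sin ?mulr0 ?addr0//; exact/integrable_cont/sin_cont.
Qed.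

Lemma increasing_seq_cvgny (N : nat -> nat) : increasing_seq N -> N @ \oo --> \oo.
Proof.
move=> Ninc; have geN q : (q <= N q)%N.
  elim: q => // q IH; apply: leq_ltn_trans IH _.
  by have := Ninc q.+1 q; rewrite !leEnat; lia.
apply/cvgnyPge => A; near=> q; apply: leq_trans (geN q).
by near: q; exact: nbhs_infty_ge.
Unshelve. all: by end_near. Qed.

(** Permissibility gives limits g h of the correlations along N; comparing them
    with c_h(N) V shows g 0 = V and leaves at most one other nonzero value. *)
Lemma staged_seq_sL : sL_sequence (staged_seq R).
Proof.
split=> [n|f fc f0].
  by have /andP[x0 /ltW x1] := staged_seq_itv R n;
    rewrite /unit_interval /= in_itv/= x0.
pose a t := complex.Re (f t); pose b t := complex.Im (f t).
have ac : {within `[0, 1], continuous a} := within_continuous_Re fc.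
have bc : {within `[0, 1], continuous b} := within_continuous_Im fc.
have [Ma aMa] := continuous_bounded ac; have [Mb bMb] := continuous_bounded bc.
pose M := Num.max Ma Mb.
have aM (x : R) : 0 <= x <= 1 -> `|a x| <= M by move=> /aMa; rewrite /M le_max => ->.
have bM (x : R) : 0 <= x <= 1 -> `|b x| <= M by move=> /bMb;
  rewrite /M le_max orbC => ->.
have [a0 b0] : \int[mu]_(x in `[0, 1]) a x = 0 /\ \int[mu]_(x in `[0, 1]) b x = 0.
  by case: f0.
split.
  exists (M + M)%:C%C; split; first exact/complex_realP/ex_intro.
  move=> e Me n _; apply: le_trans (ltW Me); apply: le_trans (normC_le_ReIm _) _.
  have /andP[x0 /ltW x1] := staged_seq_itv R n.
  by rewrite lecR lerD// ?aM ?bM// x0.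
move=> N [_ Ninc _ cv].
have Ny := increasing_seq_cvgny Ninc.
pose V := energy a b.
have rc h : (fun q => lag_average (re_corr a b) h (N q) -
  lag_coef R h (N q) * V) @ \oo --> (0 : R).
  exact: cvg_comp Ny (re_corr_cvg ac bc aM bM a0 b0 h).
have ic h : (fun q => lag_average (im_corr a b) h (N q)) @ \oo --> (0 : R).
  exact: cvg_comp Ny (im_corr_cvg aM bM h).
pose g h := limn (fun q => lag_average (re_corr a b) h (N q)).
have gc h : (fun q => lag_average (re_corr a b) h (N q)) @ \oo --> g h.
  have /cvg_complexP[rl _] := cv h.
  apply/cvg_ex; exists (complex.Re (limn (fun q => correlation (fun k =>
    f (staged_seq R k)) h (N q)))).
  move: rl; apply: cvg_trans; apply: near_eq_cvg; near=> q.
  by rewrite correlation_lag_average.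
have coefc h : (fun q => lag_coef R h (N q) * V) @ \oo --> g h.
  have -> : (fun q => lag_coef R h (N q) * V) = (fun q =>
      lag_average (re_corr a b) h (N q)
      - (lag_average (re_corr a b) h (N q) - lag_coef R h (N q) * V)).
    by apply/funext => q; ring.
  by have := cvgB (gc h) (rc h); rewrite subr0; apply.
have g0 : g 0%N = V.
  have := coefc 0%N; rewrite (_ : (fun q => _) = (fun=> V)).
    by move=> /(cvg_unique _) /(_ (cvg_cst V)) ->.
  by apply/funext => q; rewrite lag_coef0 mul1r.
(* Products of coefficients at distinct positive lags vanish for every N. *)
have gdisj h h' : (0 < h)%N -> (0 < h')%N -> h != h' -> g h * g h' = 0.
  move=> hp h'p hh'.
  have : (fun q => lag_coef R h (N q) * V * (lag_coef R h' (N q) * V)) @ \oo --> g h *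
    g h'.
    exact: cvgM.
  rewrite (_ : (fun q => _) = (fun=> 0)); last first.
    by apply/funext => q; rewrite mulrACA lag_coef_disjoint// mul0r.
  by move=> /(cvg_unique _) /(_ (cvg_cst 0)) ->.
have [h0 h0gt gh0] : exists2 h0, (0 < h0)%N & forall h, (0 < h)%N -> h != h0 -> g h = 0.
  have [[h0 [h0p gh0]]|nog] := pselect (exists h0, (0 < h0)%N /\ g h0 != 0).
    exists h0 => // h hp hh0; apply/eqP; have /eqP := gdisj h h0 hp h0p hh0.
    by rewrite mulf_eq0 (negbTE gh0) orbF.
  exists 1%N => // h hp _; apply/eqP; apply: contra_notT nog => ?.
  by exists h.
exists (density V (g h0) h0); split; first exact: density_L1.
have gE h : g h = V * (h == 0%N)%:R + g h0 * (h == h0)%:R.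
  have [->|hp] := posnP h; first by rewrite g0 (ltn_eqF h0gt) /=; ring.
  rewrite mulr0 add0r.
  have [->|hh0] := eqVneq h h0; first by rewrite mulr1.
  by rewrite mulr0 gh0.
move=> h; rewrite density_coef -gE; apply/cvg_complexP; split => /=.
  by under eq_fun do rewrite correlation_lag_average; exact: gc.
by under eq_fun do rewrite correlation_lag_average; exact: ic.
Unshelve. all: by end_near. Qed.

End Spectral.

Theorem lemma4p2 (R : realType) :
  exists x : nat -> R, sL_sequence x /\
    forall h : nat, (0 < h)%N ->
      upper_discrepancy (fun n => sub_mod1 (x (n + h)%N) (x n)) = 1 / 2.
Proof.
exists (staged_seq R); split; first exact: staged_seq_sL.
exact: upper_discrepancy_lag_diff.
Qed.
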